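(* Let $\Xi=(\mathbb{X},\rho,\mu^*,\{\lambda_k\}_{k=0}^\infty,\{\phi_k\}_{k=0}^\infty)$ be a data-defined space with exponent $q$. Assume that the product assumption holds and that there exist $\beta>0$ and $c_0>0$ such that $$\min_{y\in\mathbb{B}(x,\beta/m)}|\Phi_m(x,y)|\ge c_0m^q,\qquad x\in\mathbb{X},\ m\ge1.$$ Let $1\le p\le\infty$, $\gamma>0$ and $A>0$. Then there is a constant $c>0$, independent of $n$, $\nu$ and $x$ (but possibly depending on $A$, $\gamma$, $p$, $\beta$, $c_0$ and the fixed data), such that the following holds. Let $n\ge1$ and let $\nu$ be a positive measure satisfying $$\left|\int_{\mathbb{X}}P\,d\mu^*-\int_{\mathbb{X}}P\,d\nu\right|\le A\,\frac{\|P\|_{H_\gamma^p}}{n^\gamma},\qquad P\in\Pi_n .$$ Then $$\nu(\mathbb{B}(x,1/n))\le cn^{-q/p},\qquad x\in\mathbb{X}.$$ In particular, if $p=1$, then $|\nu|(\mathbb{X})\le c$, $\nu$ is $1/n$-regular, and $|\!|\!|\nu|\!|\!|_{R,1/n}\le c$.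
   Context: Data-defined space. $\mathbb{X}$ is a non-empty set with a quasi-metric $\rho$: $\rho\ge0$, $\rho(x,y)=0$ iff $x=y$, $\rho(x,y)=\rho(y,x)$, and $\rho(x,y)\le\kappa_1(\rho(x,z)+\rho(z,y))$ for a constant $\kappa_1\ge1$. The sets $\{y:\rho(x,y)<r\}$ ($x\in\mathbb{X}$, $r>0$) form a basis of the topology of $\mathbb{X}$. Write $\mathbb{B}(x,r)=\{y\in\mathbb{X}:\rho(x,y)\le r\}$. $\mu^*$ is a probability measure on $\mathbb{X}$; $\{\lambda_k\}_{k\ge0}$ is a non-decreasing sequence with $\lambda_0=0$, $\lambda_k\uparrow\infty$; $\{\phi_k\}_{k\ge 0}$ are continuous, bounded, integrable real-valued functions, orthonormal in $L^2(\mu^* )$, with $\phi_0\equiv1$. The system is a data-defined space if: (1) every ball $\mathbb{B}(x,r)$ is compact; (2) there are $q>0,\kappa_2>0$ with $\mu^*(\mathbb{B}(x,r))\le\kappa_2r^q$ for all $x\in\mathbb{X}$, $r>0$; (3) the series $K_t(x,y)=\sum_{k=0}^\infty \exp(-\lambda_k^2t)\phi_k(x)\phi_k(y)$ converges for all $t\in(0,1]$, $x,y\in\mathbb{X}$, and there are $\kappa_3,\kappa_4>0$ with $|K_t(x,y)|\le\kappa_3t^{-q/2}\exp(-\kappa_4\rho(x,y)^2/t)$ for all $x,y\in\mathbb{X}$, $0<t\le1$ (same $q$). The number $q$ is the exponent. Measures. All measures are complete, sigma-finite Borel measures on $\mathbb{X}$; $|\nu|$ is the total variation measure of $\nu$.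 For $d>0$, $\nu$ is $d$-regular if there is a constant $C$ with $|\nu|(\mathbb{B}(x,d))\le Cd^q$ for all $x\in\mathbb{X}$; the infimum of all such $C$ is $|\!|\!|\nu|\!|\!|_{R,d}$. Function spaces. $\Pi_n=\mathrm{span}\{\phi_j:\lambda_j<n\}$ for real $n>0$; elements of $\bigcup_n\Pi_n$ are diffusion polynomials. $L^p=L^p(\mu^* )$ with norm $\|\cdot\|_p$; $X^p$ is the $L^p$-closure of the set of diffusion polynomials. $\hat f(k)=\int f\phi_k\,d\mu^*$. For $r>0$, $W_r^p$ is the set of $f\in X^p$ for which there is $\Delta^rf\in X^p$ with $\widehat{\Delta^rf}(k)=(\lambda_k+1)^r\hat f(k)$ for all $k$. For $f\in X^p$, $\delta>0$, $\omega_r(p;f,\delta)=\inf\{\|f-f_1\|_p+\delta^r\|\Delta^rf_1\|_p: f_1\in W_r^p\}$. For $\gamma>0$ fix any $r>\gamma$; $H_\gamma^p$ is the set of $f\in X^p$ with $\|f\|_{H_\gamma^p}:=\|f\|_p+\sup_{\delta\in(0,1]}\delta^{-\gamma}\omega_r(p;f,\delta)<\infty$ (different $r>\gamma$ give equivalent norms). Product assumption. For $A,N>0$ let $\epsilon_{A,N}=\sup_{\lambda_j,\lambda_k\le N}\ \inf_{P\in\Pi_{AN}}\|\phi_j\phi_k-P\|_\infty$. The assumption is that there exists $A^*\ge2$ such that for every $R>0$, $\lim_{N\to\infty}N^R\epsilon_{A^*,N}=0$. Kernel. Fix an infinitely differentiable even function $h:\mathbb{R}\to\mathbb{R}$ with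 $h(t)=1$ for $|t|\le1/2$, $h(t)=0$ for $|t|\ge1$, and $h$ non-increasing on $[1/2,1]$. For real $N>0$, $\Phi_N(x,y)=\sum_{j=0}^\infty h(\lambda_j/N)\phi_j(x)\phi_j(y)$, $x,y\in\mathbb{X}$. ''Fixed data'' means the data-defined space, the quantities in the product assumption, $h$, and $r$. *)

(* Defs.v *)
(* MathComp-Analysis: the reals are an arbitrary R : realType. *)
From HB Require Import structures.
From mathcomp Require Import all_boot all_order all_algebra.
From mathcomp Require Import all_classical all_reals all_analysis.

Set Implicit Arguments.
Unset Strict Implicit.
Unset Printing Implicit Defensive.

Import Order.TTheory GRing.Theory Num.Theory.
Import numFieldNormedType.Exports.

Local Open Scope classical_set_scope.
Local Open Scope ring_scope.

Section QuasiMetric.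
Context {R : realType} {X : ptopologicalType}.
Variable rho : X -> X -> R.

Definition quasi_metric (kappa : R) : Prop :=
  [/\ forall x y, 0 <= rho x y,
      forall x y, rho x y = 0 <-> x = y,
      forall x y, rho x y = rho y x &
      forall x y z, rho x y <= kappa * (rho x z + rho z y)].

Definition oball (x : X) (r : R) : set X := [set y | rho x y < r].
Definition cball (x : X) (r : R) : set X := [set y | rho x y <= r].

Definition ball_basis : Prop :=
  basis [set B | exists x r, 0 < r /\ B = oball x r].

End QuasiMetric.

Section Measures.
Context {R : realType} {X : ptopologicalType}.

(* A complete measure generally lives on a sigma-algebra larger than the Borel
   one, and depending on the measure: it is <<s G>>, with G arbitrary. *)
Definition complete_sfinite_borel (G : set (set X))
    (nu : {measure set (g_sigma_algebraType G) -> \bar R}) : Prop :=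
  [/\ (open : set (set X)) `<=` <<s G >>,
      measure_is_complete nu &
      sigma_finite setT nu].

(* The total variation measure |nu|: supremum of the sums of |nu (F i)| over the
   countable measurable partitions F of E. *)
Definition tvar d (T : measurableType d) (nu : set T -> \bar R) (E : set T) :
    \bar R :=
  ereal_sup [set (\sum_(i <oo) `|nu (F i)|)%E | F in
    [set F : (set T)^nat | [/\ forall i, measurable (F i),
                               trivIset setT F &
                               \bigcup_i F i = E]]].

Variables (rho : X -> X -> R) (q : R).

Definition regularity_bound (G : set (set X))
    (nu : set (g_sigma_algebraType G) -> \bar R) (d C : R) : Prop :=
  forall x : X, (tvar nu (cball rho x d) <= (C * d `^ q)%:E)%E.

Definition regular_measure (G : set (set X))
    (nu : set (g_sigma_algebraType G) -> \bar R) (d : R) : Prop :=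
  exists C : R, regularity_bound nu d C.

Definition regularity_norm (G : set (set X))
    (nu : set (g_sigma_algebraType G) -> \bar R) (d : R) : \bar R :=
  ereal_inf [set C%:E | C in regularity_bound nu d].

End Measures.

Section Kernels.
Context {R : realType} {X : Type}.
Variables (lam : R^nat) (phi : nat -> X -> R).

Definition heat_series (t : R) (x y : X) : R^nat :=
  series (fun k => expR (- (lam k ^+ 2 * t)) * phi k x * phi k y).

Definition heat_kernel (t : R) (x y : X) : R := limn (heat_series t x y).

Definition filter_function (h : R -> R) : Prop :=
  [/\ forall k x, derivable (derive1n k h) x 1,
      forall t, h (- t) = h t,
      forall t, `|t| <= 2^-1 -> h t = 1,
      forall t, 1 <= `|t| -> h t = 0 &
      forall s t, 2^-1 <= s -> s <= t -> t <= 1 -> h t <= h s].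

Definition Phi_kernel (h : R -> R) (N : R) (x y : X) : R :=
  limn (series (fun j => h (lam j / N) * phi j x * phi j y)).

Definition Pi_ (n : R) : set (X -> R) :=
  [set P | exists (N : nat) (a : nat -> R),
     P = fun x => \sum_(j < N | lam j < n) a j * phi j x].

Definition diffusion_polynomial : set (X -> R) := \bigcup_(n in [set n : R | 0 < n]) Pi_ n.

End Kernels.

Section FunctionSpaces.
Context {R : realType} {X : ptopologicalType} {G : set (set X)}.
Variable mu : probability (g_sigma_algebraType G) R.
Variables (lam : R^nat) (phi : nat -> X -> R).

Definition Lp_norm (p : \bar R) (f : X -> R) : \bar R :=
  'N[mu]_p[(EFin \o f : g_sigma_algebraType G -> \bar R)]%E.

(* Elements of L^p are represented by functions; every notion below is
   invariant under equality mu-almost everywhere. *)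
Definition Xp (p : \bar R) : set (X -> R) :=
  [set f | (f : g_sigma_algebraType G -> R) \in Lfun mu p /\
     forall e : R, 0 < e -> exists2 P, diffusion_polynomial lam phi P &
       (Lp_norm p (f \- P)%R < e%:E)%E].

Definition fourier_coef (f : X -> R) (k : nat) : R :=
  \int[mu]_x (f x * phi k x).

(* is_Delta p r f g: f is in W_r^p and g is (a representative of) Delta^r f. *)
Definition is_Delta (p : \bar R) (r : R) (f g : X -> R) : Prop :=
  [/\ Xp p f, Xp p g &
      forall k, fourier_coef g k = (lam k + 1) `^ r * fourier_coef f k].

Definition omega (r : R) (p : \bar R) (f : X -> R) (delta : R) : \bar R :=
  ereal_inf [set e : \bar R | exists f1 g : X -> R, is_Delta p r f1 g /\
    e = (Lp_norm p (f \- f1)%R + (delta `^ r)%:E * Lp_norm p g)%E].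

Definition H_norm (r gamma : R) (p : \bar R) (f : X -> R) : \bar R :=
  (Lp_norm p f +
   ereal_sup [set (delta `^ (- gamma))%:E * omega r p f delta
             | delta in [set delta : R | (0 < delta <= 1)%R]])%E.

Definition product_eps (A N : R) : \bar R :=
  ereal_sup [set e : \bar R | exists j k : nat, [/\ lam j <= N, lam k <= N &
    e = ereal_inf [set Lp_norm +oo%E (fun x => phi j x * phi k x - P x)
                  | P in Pi_ lam phi (A * N)]]].

Definition product_assumption : Prop :=
  exists2 A : R, 2 <= A & forall S : R, 0 < S ->
    ((N `^ S)%:E * product_eps A N)%E @[N --> +oo%R] --> 0%E.

End FunctionSpaces.

Record data_defined_space (R : realType) (X : ptopologicalType)
    (rho : X -> X -> R) (G : set (set X))
    (mu : probability (g_sigma_algebraType G) R)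
    (lam : R^nat) (phi : nat -> X -> R) (q : R) : Prop := DataDefinedSpace {
  dds_quasi_metric : exists2 kappa1 : R, 1 <= kappa1 & quasi_metric rho kappa1;
  dds_basis : ball_basis rho;
  dds_measure : complete_sfinite_borel mu;
  dds_lam0 : lam 0%N = 0;
  dds_lam_nd : {homo lam : i j / (i <= j)%N >-> i <= j};
  dds_lam_pinfty : lam @ \oo --> +oo%R;
  dds_phi_continuous : forall k, continuous (phi k);
  dds_phi_bounded : forall k, exists M : R, forall x, `|phi k x| <= M;
  dds_phi_integrable : forall k, mu.-integrable setT (EFin \o phi k);
  dds_phi_orthonormal : forall j k,
    (\int[mu]_x (phi j x * phi k x)%:E = ((j == k)%:R)%:E)%E;
  dds_phi0 : forall x, phi 0%N x = 1;
  dds_ball_compact : forall x (r : R), 0 < r -> compact (cball rho x r);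
  dds_q_gt0 : 0 < q;
  dds_ball_measure : exists2 kappa2 : R, 0 < kappa2 &
    forall x (r : R), 0 < r -> (mu (cball rho x r) <= (kappa2 * r `^ q)%:E)%E;
  dds_heat_cvg : forall (t : R) x y, 0 < t <= 1 ->
    cvgn (heat_series lam phi t x y);
  dds_heat_bound : exists kappa3 kappa4 : R, [/\ 0 < kappa3, 0 < kappa4 &
    forall (t : R) x y, 0 < t <= 1 ->
      `|heat_kernel lam phi t x y| <=
        kappa3 * t `^ (- (q / 2)) * expR (- (kappa4 * rho x y ^+ 2 / t))]
}.

(* Main.v *)
(* Take [m] a small multiple of [n] and test the quadrature hypothesis on a
   polynomial [psi] of [Pi_ n] approximating [Phi_m(x, .)^2], which the product
   assumption provides.  Since [psi >= c m^(2q)] on the ball [B(x, 1/n)], up to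
   bounded errors, [n^(2q) nu(B(x, 1/n))] is at most the [mu]-integral of [psi],
   which is O(n^q), plus [A n^(- gamma)] times the H_gamma^p norm of [psi].
   The latter is O(n^gamma n^(2q - q/p)) by the Bernstein inequality
   [|Delta^r P|_p <= C n^r |P|_p] on [Pi_ n], applied for p = 1 and p = oo.
   The Bernstein inequality follows from uniform L^1 bounds for the kernels of
   dyadic pieces of the multiplier [(lam + 1)^r]: such a piece is a smooth function
   of the heat operator [U = exp(- L^2 / N^2)], hence is approximated by polynomials
   in [U] of degree [k], with an error that is small in L^2, while by the Gaussian
   bound a polynomial of degree [k] in [U] is negligible at distance larger than
   [C k / N].  Finally, the errors in the product assumption are controlled only
   [mu]-almost everywhere, but [mu] has full support, so that they are controlled
   everywhere, in particular for [nu]. *)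
Require Import Defs.
From HB Require Import structures.
From mathcomp Require Import all_boot all_order all_algebra.
From mathcomp Require Import all_classical all_reals all_analysis.
From mathcomp Require Import measurable_realfun ess_sup_inf ring lra.

Set Implicit Arguments.
Unset Strict Implicit.
Unset Printing Implicit Defensive.
Import Order.TTheory GRing.Theory Num.Theory.
Import numFieldNormedType.Exports.
Local Open Scope classical_set_scope.
Local Open Scope ring_scope.

(** * Polynomial approximation of smooth functions *)

Section PolynomialApproximation.
Context {R : realType}.
Implicit Types (f g F : R -> R) (a b : nat -> R) (n k N S : nat) (u c : R).

(** Three rates have to fit. A polynomial of degree about [k] that approximates a smooth function
    may have coefficients of total size [3 ^+ k]; the Gaussian bound at distance [C0 * k / N], with
    [C0] large, gains [expR (- (3 * k))], which wins. The approximation error is [k^(-S/2)], as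
    Bernstein polynomials give half a power of [k] per derivative. With [S = 2 * (b + 2)] and an
    integer [b >= q], the L^2 error beats the volume [k^b N^(-q)] of the annulus at that distance
    with [k^(-2)] to spare, so the sum over the annuli is bounded uniformly in [N]. The heat bounds
    hold only up to time 1, that is up to degree about [N^2] in the heat operator. The annuli stop
    there, and the rest of the space is one region: its measure, at most 1, is already below a
    constant times [N^(-q) k^b]. The product assumption speaks only of large [N]. For bounded [n]
    the ball estimate therefore comes from the total mass of [nu], which testing with the constant 1
    controls; the same total mass controls the [nu]-integral of the product error. *)

Definition poly_bound n (B : R) f := exists2 c : nat -> R,
  \sum_(i < n) `|c i| <= B & forall u, f u = \sum_(i < n) c i * u ^+ i.

Lemma poly_boundW n n' (B B' : R) f : (n <= n')%N -> B <= B' ->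
  poly_bound n B f -> poly_bound n' B' f.
Proof.
move=> nn' BB' [c cB fE].
have E (G : nat -> R -> R) : (forall i, G i 0 = 0) ->
    \sum_(i < n') G i (if (i < n)%N then c i else 0) = \sum_(i < n) G i (c i).
  move=> G0; rewrite (big_ord_widen n' (fun i => G i (c i)) nn') [RHS]big_mkcond /=.
  by apply: eq_bigr => i _; case: ifP.
exists (fun i => if (i < n)%N then c i else 0).
  by rewrite (E (fun _ x => `|x|)) ?(le_trans cB) // => i; rewrite normr0.
by move=> u; rewrite (E (fun i x => x * u ^+ i)) // => i; rewrite mul0r.
Qed.

Lemma poly_boundD n (B B' : R) f g : poly_bound n B f -> poly_bound n B' g ->
  poly_bound n (B + B') (fun u => f u + g u).
Proof.
move=> [c cB fE] [c' cB' gE]; exists (fun i => c i + c' i).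
  by apply: le_trans (lerD cB cB'); rewrite -big_split; apply: ler_sum => i _ /=; apply: ler_normD.
by move=> u; rewrite fE gE -big_split; apply: eq_bigr => i _; rewrite mulrDl.
Qed.

Lemma poly_boundZ n (B k : R) f : poly_bound n B f ->
  poly_bound n (`|k| * B) (fun u => k * f u).
Proof.
move=> [c cB fE]; exists (fun i => k * c i).
  under eq_bigr do rewrite normrM.
  by rewrite -mulr_sumr ler_wpM2l.
by move=> u; rewrite fE mulr_sumr; apply: eq_bigr => i _; rewrite mulrA.
Qed.

Lemma poly_boundX n (B : R) f : poly_bound n B f ->
  poly_bound n.+1 B (fun u => u * f u).
Proof.
move=> [c cB fE]; exists (fun i => if i is j.+1 then c j else 0).
  by rewrite big_ord_recl /= normr0 add0r.
move=> u; rewrite fE big_ord_recl mul0r add0r mulr_sumr.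
by apply: eq_bigr => i _; rewrite exprS /=; ring.
Qed.

Lemma poly_bound_cst n (k : R) : poly_bound n.+1 `|k| (fun=> k).
Proof.
apply: (@poly_boundW 1 _ `|k|) => //; exists (fun=> k); first by rewrite big_ord1.
by move=> u; rewrite big_ord1 expr0 mulr1.
Qed.

Lemma poly_bound_primitive n (B : R) f : poly_bound n B f ->
  exists g, [/\ poly_bound n.+1 B g, g 0 = 0 & forall u, is_derive u 1 g (f u)].
Proof.
move=> [c cB fE]; pose c' i := if i is j.+1 then c j / j.+1%:R else 0.
exists (fun u => \sum_(i < n.+1) c' i * u ^+ i); split.
- exists c' => //; rewrite big_ord_recl /= normr0 add0r; apply: le_trans cB.
  apply: ler_sum => i _; rewrite normrM ler_piMr // ger0_norm ?invr_ge0 //.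
  by rewrite invf_le1 ?ler1n.
- rewrite big_ord_recl mul0r add0r big1 // => i _.
  by rewrite expr0n /= mulr0.
move=> u; rewrite fE.
have -> : (fun u => \sum_(i < n.+1) c' i * u ^+ i) =
          \sum_(i < n) (fun u => c i / i.+1%:R * u ^+ i.+1).
  apply/funext => v; rewrite fct_sumE big_ord_recl mul0r add0r.
  by apply: eq_bigr => i _.
apply: is_derive_sum => i.
rewrite (_ : (fun v : R => _) = (c i / i.+1%:R) \*: (@id R ^+ i.+1)); last first.
  by apply/funext => v; rewrite /= exprfctE.
apply: is_derive_eq; rewrite /GRing.scale /= mulr1 mulrA.
by rewrite divfK ?pnatr_eq0.
Qed.

(* The Bernstein polynomial with nodal values [a], by de Casteljau's recursion. *)
Fixpoint bernstein N a u : R :=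
  if N is N'.+1 then u * bernstein N' (a \o S) u + (1 - u) * bernstein N' a u
  else a 0%N.

Lemma bernsteinD N a b u : bernstein N (fun i => a i + b i) u =
  bernstein N a u + bernstein N b u.
Proof.
elim: N a b => //= N IH a b; rewrite (IH (a \o S) (b \o S)) IH; ring.
Qed.

Lemma bernstein_scale N (k : R) a u :
  bernstein N (fun i => k * a i) u = k * bernstein N a u.
Proof. by elim: N a => //= N IH a; rewrite (IH (a \o S)) IH; ring. Qed.

Lemma bernstein_cst N (k : R) u : bernstein N (fun=> k) u = k.
Proof. by elim: N => //= N IH; rewrite (_ : _ \o _ = fun=> k) // IH; ring. Qed.

(** Second moment about [c] of a binomial law: squared bias plus variance. An arbitrary [c] is
    needed because the shift of the nodes in the recursion replaces [c] by [c - 1]. *)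
Lemma bernstein_var N c u : bernstein N (fun i => (i%:R - c) ^+ 2) u =
  (N%:R * u - c) ^+ 2 + N%:R * u * (1 - u).
Proof.
elim: N c => [|N IH] c /=; first by rewrite !mul0r addr0.
have -> : (fun i => (i%:R - c) ^+ 2) \o S = (fun i => (i%:R - (c - 1)) ^+ 2).
  by apply/funext => i /=; rewrite -natr1; ring.
by rewrite !IH -natr1; ring.
Qed.

Lemma le_bernstein N a b u : 0 <= u <= 1 -> (forall i, (i <= N)%N -> a i <= b i) ->
  bernstein N a u <= bernstein N b u.
Proof.
move=> /andP[u0 u1]; elim: N a b => [a b|N IH a b ab] /=; first exact.
apply: lerD; apply: ler_wpM2l => //; rewrite ?subr_ge0 //; apply: IH => i iN /=.
  exact: ab.
by apply: ab; exact: leqW.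
Qed.

(** A de Casteljau step multiplies by [u] and by [1 - u], whose absolute coefficient sums are 1 and
    2: a factor 3 per step. *)
Lemma bernstein_poly_bound N a (B : R) : (forall i, (i <= N)%N -> `|a i| <= B) ->
  poly_bound N.+1 (B * 3 ^+ N) (bernstein N a).
Proof.
elim: N a => [a aB|N IH a aB].
  rewrite expr0 mulr1; apply: poly_boundW (poly_bound_cst 0 (a 0%N)) => //.
  exact: aB.
have h1 := IH (a \o S) (fun i iN => aB i.+1 iN).
have h2 := IH a (fun i iN => aB i (leqW iN)).
apply: (@poly_boundW N.+2 _ (B * 3 ^+ N + (B * 3 ^+ N + `|-1| * (B * 3 ^+ N)))) => //.
  by rewrite normrN1 exprS; lra.
have -> : bernstein N.+1 a = (fun u => u * bernstein N (a \o S) u +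
   (bernstein N a u + (-1) * (u * bernstein N a u))).
  by apply/funext => u /=; ring.
apply: poly_boundD; first exact: poly_boundX.
apply: poly_boundD; first exact: poly_boundW h2.
by apply: poly_boundZ; exact: poly_boundX.
Qed.

Lemma bernstein_lipschitz N (G : R -> R) (e : R) u : 0 <= e ->
  (forall v w, 0 <= v <= 1 -> 0 <= w <= 1 -> `|G v - G w| <= e * `|v - w|) ->
  0 <= u <= 1 ->
  `|G u - bernstein N.+1 (fun i => G (i%:R / N.+1%:R)) u| <= e / Num.sqrt N.+1%:R.
Proof.
move=> e0 GL u01; set s := Num.sqrt _.
have s0 : 0 < s by rewrite sqrtr_gt0 ltr0n.
have sE : N.+1%:R = s ^+ 2 by rewrite sqr_sqrtr.
(* Majorant of the error at the nodes: [|x| <= (s * x ^+ 2 + s^-1) / 2] replaces the linear modulus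
   by a quadratic one, whose Bernstein polynomial [bernstein_var] gives exactly. The weight [s]
   balances both terms. *)
pose d i : R := e / (2 * s ^+ 3) * (i%:R - N.+1%:R * u) ^+ 2 + e / (2 * s).
have dE : bernstein N.+1 d u <= e / s.
  rewrite bernsteinD bernstein_scale bernstein_var bernstein_cst subrr expr0n add0r sE.
  have -> : e / (2 * s ^+ 3) * (s ^+ 2 * u * (1 - u)) + e / (2 * s) =
     e / s * ((u * (1 - u) + 1) / 2) by field; rewrite gt_eqF.
  rewrite ler_piMr ?divr_ge0 // ?ltW //.
  by move/andP: u01 => [? ?]; nra.
have close i : (i <= N.+1)%N -> `|G (i%:R / N.+1%:R) - G u| <= d i.
  move=> iN; apply: le_trans (GL _ _ _ u01) _.
    by rewrite divr_ge0 //= ler_pdivrMr ?ltr0n // mul1r ler_nat.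
  rewrite /d sE; set x := i%:R / _ - u.
  have -> : i%:R - s ^+ 2 * u = s ^+ 2 * x by rewrite /x; field; rewrite gt_eqF.
  have -> : e / (2 * s ^+ 3) * (s ^+ 2 * x) ^+ 2 + e / (2 * s) =
     e * ((s * x ^+ 2 + s^-1) / 2) by field; rewrite gt_eqF.
  rewrite ler_wpM2l // -real_normK ?num_real // -subr_ge0.
  have -> : (s * `|x| ^+ 2 + s^-1) / 2 - `|x| = (s * `|x| - 1) ^+ 2 / (2 * s).
    by field; rewrite gt_eqF.
  by rewrite divr_ge0 ?sqr_ge0 // mulr_ge0 // ltW.
rewrite distrC ler_norml; apply/andP; split.
  rewrite -subr_ge0; have := @le_bernstein N.+1 (fun i => (-1) * d i + G u)
    (fun i => G (i%:R / N.+1%:R)) u u01.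
  rewrite bernsteinD bernstein_scale bernstein_cst => H.
  have/H : forall i, (i <= N.+1)%N -> -1 * d i + G u <= G (i%:R / N.+1%:R).
    by move=> i /close; rewrite ler_norml => /andP[]; lra.
  by move: dE; lra.
have := @le_bernstein N.+1 (fun i => G (i%:R / N.+1%:R)) (fun i => d i + G u) u u01.
rewrite bernsteinD bernstein_cst => H.
have/H : forall i, (i <= N.+1)%N -> G (i%:R / N.+1%:R) <= d i + G u.
  by move=> i /close; rewrite ler_norml => /andP[]; lra.
by move: dE; lra.
Qed.

(** [3 ^+ k] is the cost of Bernstein polynomials, and one factor [k^(-1/2)] per order of smoothness
    is their rate on Lipschitz functions. Each order also costs one integration, hence the degree
    [k + S]. *)
Definition poly_approx S (K : R) F := forall k, exists2 Q,
  poly_bound (k + S).+1 (K * 3 ^+ k) Q &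
  forall u, 0 <= u <= 1 -> `|F u - Q u| <= K * (Num.sqrt k.+1%:R)^-1 ^+ S.

Lemma poly_approx0 (K : R) F : 0 <= K -> (forall u, 0 <= u <= 1 -> `|F u| <= K) ->
  poly_approx 0 K F.
Proof.
move=> K0 FK k; exists (fun=> 0).
  apply: poly_boundW (poly_bound_cst 0 0) => //.
  by rewrite normr0 mulr_ge0 // exprn_ge0.
by move=> u u01; rewrite subr0 expr0 mulr1; exact: FK.
Qed.

Lemma poly_approxD S (K K' : R) F F' : poly_approx S K F -> poly_approx S K' F' ->
  poly_approx S (K + K') (fun u => F u + F' u).
Proof.
move=> h h' k; have [Q q1 q2] := h k; have [Q' q1' q2'] := h' k.
exists (fun u => Q u + Q' u); first by rewrite mulrDl; exact: poly_boundD.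
move=> u u01; rewrite mulrDl opprD addrACA.
by apply: le_trans (ler_normD _ _) _; apply: lerD; [exact: q2|exact: q2'].
Qed.

Lemma poly_approxZ S (K k : R) F : poly_approx S K F -> poly_approx S (`|k| * K) (fun u => k * F u).
Proof.
move=> h j; have [Q q1 q2] := h j.
exists (fun u => k * Q u); first by rewrite -mulrA; exact: poly_boundZ.
by move=> u u01; rewrite -mulrBr normrM -mulrA ler_wpM2l // q2.
Qed.

(** If [Q] approximates [F'] and [P] is its primitive, then [F - P] is Lipschitz with the error for
    [F'] as its constant. A Bernstein polynomial of this remainder gains the next factor
    [k^(-1/2)]. *)
Lemma poly_approx_derive S (K K0 : R) F F' : 0 <= K -> poly_approx S K F' ->
  (forall u, is_derive u 1 F (F' u)) -> `|F 0| <= K0 ->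
  poly_approx S.+1 (K0 + 4 * K) F.
Proof.
move=> Kge0 appF' dF F0 k; have [Q Qb Qe] := appF' k.
have [P [Pb P0 dP]] := poly_bound_primitive Qb.
set s := Num.sqrt k.+1%:R in Qe *.
have s1 : 1 <= s by rewrite -sqrtr1 ler_sqrt // ?ler0n // ler1n.
have s0 : 0 < s by exact: lt_le_trans s1.
set e := K * s^-1 ^+ S in Qe *.
have e0 : 0 <= e by rewrite mulr_ge0 // exprn_ge0 // invr_ge0 ltW.
have eK : e <= K.
  by rewrite ler_piMr // exprn_ile1 // ?invr_ge0 ?invf_le1 // ltW.
pose G u := F u - P u - F 0.
have dG u : is_derive u 1 G (F' u - Q u).
  have d1 := dF u; have d2 := dP u.
  rewrite (_ : G = (F \- P) \- cst (F 0)) //.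
  by apply: is_derive_eq; rewrite subr0.
have GL0 v w : 0 <= v -> v <= w -> w <= 1 -> `|G w - G v| <= e * (w - v).
  move=> v0 vw w1.
  have [|z zvw ->] := @MVT_segment R G (fun u => F' u - Q u) v w vw (fun x _ => dG x).
    by apply: derivable_within_continuous => x _; have := dG x; case.
  rewrite normrM (ger0_norm (_ : 0 <= w - v)) ?subr_ge0 //.
  apply: ler_wpM2r; rewrite ?subr_ge0 //; apply: Qe.
  by move: zvw; rewrite in_itv /= => /andP[]; lra.
have GL v w : 0 <= v <= 1 -> 0 <= w <= 1 -> `|G v - G w| <= e * `|v - w|.
  move=> /andP[v0 v1] /andP[w0 w1]; have [vw|wv] := leP v w.
    by rewrite distrC (distrC v) (ger0_norm (_ : 0 <= w - v)) ?subr_ge0 // GL0.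
  have {}wv := ltW wv.
  by rewrite (ger0_norm (_ : 0 <= v - w)) ?subr_ge0 // GL0.
have G0 : G 0 = 0 by rewrite /G P0; ring.
have Gk i : (i <= k.+1)%N -> `|G (i%:R / k.+1%:R)| <= K.
  move=> ik; have x0 : (0 : R) <= i%:R / k.+1%:R by rewrite divr_ge0.
  have x1 : (i%:R / k.+1%:R : R) <= 1.
    by rewrite ler_pdivrMr ?ltr0n // mul1r ler_nat.
  rewrite -[G _]subr0 -G0; apply: le_trans (GL _ _ _ _) _; rewrite ?x0 ?x1 ?lexx ?ler01 //.
  by rewrite subr0 ger0_norm //; apply: le_trans eK; rewrite ler_piMr.
have Bb := bernstein_poly_bound Gk.
exists (fun u => F 0 + (P u + bernstein k.+1 (fun i => G (i%:R / k.+1%:R)) u)).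
  have T : (1 : R) <= 3 ^+ k by apply: exprn_ege1; lra.
  apply: (@poly_boundW (k + S).+2 _ (K0 + (K * 3 ^+ k + K * 3 ^+ k.+1))).
  - by rewrite addnS.
  - rewrite exprS; have : 0 <= K0 * (3 ^+ k - 1).
      by apply: mulr_ge0; rewrite ?subr_ge0 //; apply: le_trans F0.
    lra.
  apply: poly_boundD; first exact: poly_boundW (poly_bound_cst 0 _).
  apply: poly_boundD; first exact: Pb.
  by apply: poly_boundW Bb => //; rewrite ltnS ltnS leq_addr.
move=> u u01.
have -> : F u - (F 0 + (P u + bernstein k.+1 (fun i => G (i%:R / k.+1%:R)) u)) =
  G u - bernstein k.+1 (fun i => G (i%:R / k.+1%:R)) u by rewrite /G; ring.
apply: le_trans (bernstein_lipschitz _ e0 GL u01) _.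
rewrite -/s exprS [s^-1 * _]mulrC mulrA.
apply: ler_wpM2r; first by rewrite invr_ge0 ltW.
apply: ler_wpM2r; first by rewrite exprn_ge0 // invr_ge0 ltW.
by have := le_trans (normr_ge0 _) F0; lra.
Qed.

End PolynomialApproximation.

(** * Smooth multipliers as functions of the heat operator *)

Section CompactlySupportedSymbols.
Context {R : realType}.
Implicit Types (f g a : R -> R) (k S : nat) (s u e eps : R).

(** Only the open half-line matters: the symbols involve [s^-1], and they are supported away from
    0. *)
Fixpoint smooth_pos k f : Prop :=
  if k is k'.+1 then
    exists2 f', forall s, 0 < s -> is_derive s 1 f (f' s) & smooth_pos k' f'
  else forall s, 0 < s -> {for s, continuous f}.

Lemma smooth_pos_continuous k f s : smooth_pos k f -> 0 < s -> {for s, continuous f}.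
Proof.
case: k => [|k] /=; first exact.
move=> [f' df _] s0; have := df _ s0 => dfs.
by apply: differentiable_continuous; apply/derivable1_diffP; case: dfs.
Qed.

Lemma smooth_posS k f : smooth_pos k.+1 f -> smooth_pos k f.
Proof.
elim: k f => [f h s|k IH f [f' df /IH f'k]]; first exact: smooth_pos_continuous h.
by exists f'.
Qed.

Lemma smooth_posD k f g : smooth_pos k f -> smooth_pos k g ->
  smooth_pos k (fun s => f s + g s).
Proof.
elim: k f g => [f g cf cg s s0|k IH f g [f' df f'k] [g' dg g'k]].
  by apply: continuousD; [exact: cf|exact: cg].
exists (fun s => f' s + g' s); last exact: IH.
by move=> s s0; have d1 := df _ s0; have d2 := dg _ s0; exact: is_deriveD.
Qed.

Lemma smooth_posM k f g : smooth_pos k f -> smooth_pos k g ->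
  smooth_pos k (fun s => f s * g s).
Proof.
elim: k f g => [f g cf cg s s0|k IH f g fk gk].
  by apply: continuousM; [exact: cf|exact: cg].
have [f' df f'k] := fk; have [g' dg g'k] := gk.
exists (fun s => f s * g' s + g s * f' s).
  by move=> s s0; have d1 := df _ s0; have d2 := dg _ s0; exact: is_deriveM.
by apply: smooth_posD; apply: IH => //; exact: smooth_posS.
Qed.

Lemma smooth_pos_cst k (c : R) : smooth_pos k (fun=> c).
Proof.
elim: k c => [c s _|k IH c]; first exact: cst_continuous.
by exists (fun=> 0) => // s _; exact: is_derive_cst.
Qed.

Lemma smooth_pos_id k : smooth_pos k id.
Proof.
case: k => [s _|k]; first by [].
by exists (fun=> 1); [move=> s _; exact: is_derive_id|exact: smooth_pos_cst].
Qed.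

Lemma smooth_pos_inv k : smooth_pos k (fun s => s^-1).
Proof.
elim: k => [s s0|k IH]; first by apply: inv_continuous; rewrite gt_eqF.
exists (fun s => -1 * (s^-1 * s^-1)).
  move=> s s0; have s0' : id s != 0 by rewrite gt_eqF.
  apply: is_derive_eq (is_deriveV s0' (is_derive_id s 1)) _.
  by rewrite /GRing.scale /= mulr1 expr2 invfM mulN1r.
by apply: smooth_posM (smooth_pos_cst _ _) _; exact: smooth_posM.
Qed.

Lemma smooth_pos_expR_sqr k : smooth_pos k (fun s => expR (s * s)).
Proof.
have dE s : is_derive s 1 (fun s => expR (s * s)) (expR (s * s) * (s + s)).
  have -> : (fun s => expR (s * s)) = expR \o (@id R * @id R) by [].
  apply: is_derive1_comp; apply: is_derive_eq.
  by rewrite /GRing.scale /= !mulr1.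
elim: k => [s s0|k IH].
  by apply: differentiable_continuous; apply/derivable1_diffP; case: (dE s).
exists (fun s => expR (s * s) * (s + s)); first by move=> s _.
by apply: smooth_posM => //; apply: smooth_posD; exact: smooth_pos_id.
Qed.

Lemma smooth_pos_derive1n (h : R -> R) (c : R) j k :
  (forall k x, derivable (derive1n k h) x 1) ->
  smooth_pos k (fun s => derive1n j h (c * s)).
Proof.
move=> hd.
have dE i s : is_derive s 1 (fun s => derive1n i h (c * s)) (c * derive1n i.+1 h (c * s)).
  have -> : (fun s => derive1n i h (c * s)) = derive1n i h \o (c \*: @id R) by [].
  rewrite [c * _]mulrC; apply: is_derive1_comp.
    by rewrite derive1nS derive1E; apply: derivableP; exact: hd.
  by apply: is_derive_eq; rewrite /GRing.scale /= mulr1.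
elim: k j => [j s s0|k IH j].
  by apply: differentiable_continuous; apply/derivable1_diffP; case: (dE j s).
exists (fun s => c * derive1n j.+1 h (c * s)); first by move=> s _.
by apply: smooth_posM => //; exact: smooth_pos_cst.
Qed.

Definition supported a := forall s, 0 <= s < 2^-1 \/ 2 < s -> a s = 0.

(* Inverts [s |-> expR (- s ^+ 2)]; equal to 0 outside of [0 < u < 1]. *)
Let sq u := Num.sqrt (- ln u).

Lemma sq_near0 u : u <= 0 -> \forall v \near u, sq v = 0 \/ 2 < sq v.
Proof.
move=> u0; have e0 : 0 < expR (- 5 : R) by exact: expR_gt0.
near=> v; have v5 : v < expR (-5).
  by near: v; apply: lt_nbhsl; exact: le_lt_trans e0.
have [v0|v0] := leP v 0; first by left; rewrite /sq ln0 // oppr0 sqrtr0.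
right; have : ln v < - 5 by rewrite -ltr_expR lnK.
rewrite /sq => lv; have -> : 2 = Num.sqrt (2 ^+ 2) :> R by rewrite sqrtr_sqr ger0_norm.
by rewrite ltr_sqrt; lra.
Unshelve. all: by end_near. Qed.

Lemma sq_near1 u : 1 <= u -> \forall v \near u, 0 <= sq v < 2^-1.
Proof.
move=> u1; near=> v.
have v5 : expR (- 5^-1) < v.
  near: v; apply: lt_nbhsr; apply: lt_le_trans u1.
  by rewrite expR_lt1; lra.
have lv : - 5^-1 < ln v by rewrite -ltr_expR lnK // posrE; exact: lt_trans (expR_gt0 _) v5.
rewrite sqrtr_ge0 /=.
have -> : 2^-1 = Num.sqrt (2^-1 ^+ 2) :> R by rewrite sqrtr_sqr ger0_norm.
by rewrite /sq ltr_sqrt; lra.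
Unshelve. all: by end_near. Qed.

(** The derivative of [sq] written in terms of [s = sq u]: it is [- u^-1 / (2 * s)], and
    [u^-1 = expR (s * s)]. Thus derivatives of functions of [sq] are again functions of [sq], and
    the argument can be iterated. *)
Let w s := -1 * expR (s * s) * (2 * s)^-1.

Lemma smooth_pos_w k : smooth_pos k w.
Proof.
apply: smooth_posM.
  by apply: smooth_posM; [exact: smooth_pos_cst|exact: smooth_pos_expR_sqr].
rewrite (_ : (fun s : R => (2 * s)^-1) = fun s => 2^-1 * s^-1); last first.
  by apply/funext => s; rewrite invfM.
by apply: smooth_posM; [exact: smooth_pos_cst|exact: smooth_pos_inv].
Qed.

Lemma is_derive_comp_sq f f' u : supported f ->
  (forall s, 0 < s -> is_derive s 1 f (f' s)) ->
  is_derive u 1 (f \o sq) (f' (sq u) * w (sq u)).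
Proof.
move=> fs df.
have f'0 s : 0 < s -> (s < 2^-1 \/ 2 < s) -> f' s = 0.
  move=> s0 h; have d1 := df _ s0.
  have d0 : is_derive s 1 f 0.
    apply: (@near_eq_is_derive _ _ _ (cst 0)).
    have [h'|h'] := h.
      near=> v; apply/esym/fs; left; apply/andP; split; near: v.
        by have := lt_nbhsr s0; apply: filterS => v /ltW.
      by exact: lt_nbhsl.
    near=> v; apply/esym/fs; right; near: v; exact: lt_nbhsr.
  by rewrite -(@derive_val _ _ _ _ _ _ _ d1) (@derive_val _ _ _ _ _ _ _ d0).
have z u' : (\forall v \near u', (f \o sq) v = 0) -> f' (sq u') * w (sq u') = 0 ->
    is_derive u' 1 (f \o sq) (f' (sq u') * w (sq u')).
  move=> nz ->; apply: (@near_eq_is_derive _ _ _ (cst 0)).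
  by apply: filterS nz => v ->.
(* Since [0^-1 = 0], the claimed derivative is 0 wherever [sq u = 0], whatever the value of [f'] at
   0. *)
have w0 : w 0 = 0 by rewrite /w !mulr0 invr0 mulr0.
have [u0|u0] := leP u 0.
  apply: z; last by rewrite {2}/sq ln0 // oppr0 sqrtr0 w0 mulr0.
  apply: filterS (sq_near0 u0) => v [/= ->|?]; apply: fs; last by right.
  by left; rewrite lexx invr_gt0 ltr0n.
have [u1|u1] := leP 1 u.
  apply: z; last first.
    have : sq u = 0 by rewrite /sq ler0_sqrtr // oppr_le0 ln_ge0.
    by move=> ->; rewrite w0 mulr0.
  by apply: filterS (sq_near1 u1) => v hv; apply: fs; left.
have l0 : 0 < - ln u by rewrite oppr_gt0 ln_lt0 // u0.
have s0 : 0 < sq u by rewrite sqrtr_gt0.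
have d1 := df _ s0.
have d2 := is_derive1_ln u0.
have d3 : is_derive ((\- (@ln R)) u) 1 Num.sqrt (2 * Num.sqrt (- ln u))^-1.
  exact: is_derive1_sqrt.
have d4 : is_derive u 1 (\- (@ln R)) (- u^-1) by exact: is_deriveN.
have -> : w (sq u) = (2 * Num.sqrt (- ln u))^-1 * - u^-1.
  rewrite /w /sq -expr2 sqr_sqrtr ?ltW // expRN lnK //; ring.
by apply: is_derive1_comp; exact: is_derive1_comp.
Unshelve. all: by end_near. Qed.

Lemma powR_le_expR (x e : R) : 2^-1 <= x <= 3 -> x `^ e <= expR (`|e| * 2).
Proof.
move=> /andP[x2 x3]; have x0 : 0 < x by apply: lt_le_trans x2; rewrite invr_gt0.
rewrite /powR gt_eqF // ler_expR; apply: le_trans (ler_norm _) _; rewrite normrM.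
apply: ler_wpM2l => //; rewrite ler_norml; apply/andP; split.
  have : ln x^-1 <= 1.
    have -> : x^-1 = 1 + (x^-1 - 1) by ring.
    apply: le_trans (le_ln1Dx _) _.
      by rewrite ltrBrDl subrr invr_gt0.
    have : x^-1 <= 2 by rewrite invf_ple ?posrE.
    lra.
  by rewrite lnV //; lra.
have -> : x = 1 + (x - 1) by ring.
by apply: le_trans (le_ln1Dx _) _; lra.
Qed.

Lemma supported_bounded a : smooth_pos 0 a -> supported a ->
  exists M, forall s, 0 <= s -> `|a s| <= M.
Proof.
move=> ac sa; have le2 : (2^-1 : R) <= 2 by lra.
have cc : {within `[2^-1, 2], continuous (fun s => `|a s|)}.
  apply: continuous_in_subspaceT => s; rewrite inE /= in_itv /= => /andP[s2 _].
  have s0 : 0 < s by apply: lt_le_trans s2; rewrite invr_gt0.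
  by apply: continuous_comp; [exact: ac|exact: norm_continuous].
have [c _ cM] := EVT_max le2 cc.
exists `|a c| => s s0; have [s2|s2] := ltP s 2^-1.
  by rewrite sa ?normr0 //; left; rewrite s0.
have [s3|s3] := ltP 2 s; first by rewrite sa ?normr0 //; right.
by apply: cM; rewrite in_itv /= s2.
Qed.

(** Differentiation in [u] yields two symbols of the same shape, one with exponent [e - 1], so
    induction on [S] applies for all [e] at once. Uniformity in [eps] holds because [s + eps] stays
    in [[1/2, 3]] on the support. In the application [eps = N^-1], which accounts for the 1 in
    [lam j + 1]. *)
Lemma poly_approx_symbol S a e : smooth_pos S a -> supported a ->
  exists2 K, 0 <= K & forall eps, 0 <= eps <= 1 ->
    poly_approx S K (fun u => (sq u + eps) `^ e * a (sq u)).
Proof.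
elim: S a e => [a e ac sa|S IH a e aS sa].
  have [M aM] := supported_bounded ac sa.
  have M0 : 0 <= M by apply: le_trans (aM 0 _).
  exists (expR (`|e| * 2) * M); first by rewrite mulr_ge0 // expR_ge0.
  move=> eps /andP[e0 e1]; apply: poly_approx0; first by rewrite mulr_ge0 // expR_ge0.
  move=> u _; rewrite normrM (ger0_norm (powR_ge0 _ _)).
  have sq0 : 0 <= sq u by exact: sqrtr_ge0.
  have [s2|s2] := ltP (sq u) 2^-1.
    rewrite sa ?normr0 ?mulr0 ?mulr_ge0 ?expR_ge0 //; left.
    by rewrite sq0.
  have [s3|s3] := ltP 2 (sq u).
    by rewrite sa ?normr0 ?mulr0 ?mulr_ge0 ?expR_ge0 //; right.
  by apply: ler_pM; rewrite ?powR_ge0 ?aM // powR_le_expR //; lra.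
have [a' da a'S] := aS.
have sw : supported (fun s => a s * w s) by move=> s hs; rewrite sa // mul0r.
have sw' : supported (fun s => a' s * w s).
  move=> s hs; have [->|s0] := eqVneq s 0; first by rewrite /w !mulr0 invr0 !mulr0.
  have s0' : 0 < s by case: hs => [/andP[]|]; rewrite ?lt_def ?s0 //; lra.
  have d1 := da _ s0'.
  suff d0 : is_derive s 1 a 0.
    by rewrite -(@derive_val _ _ _ _ _ _ _ d1) (@derive_val _ _ _ _ _ _ _ d0) mul0r.
  apply: (@near_eq_is_derive _ _ _ (cst 0)).
  case: hs => [/andP[_ h']|h'].
    near=> v; apply/esym/sa; left; apply/andP; split; near: v.
      by have := lt_nbhsr s0'; apply: filterS => v /ltW.
    by exact: lt_nbhsl.
  near=> v; apply/esym/sa; right; near: v; exact: lt_nbhsr.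
have [K1 K10 h1] := IH _ (e - 1) (smooth_posM (smooth_posS aS) (smooth_pos_w S)) sw.
have [K2 K20 h2] := IH _ e (smooth_posM a'S (smooth_pos_w S)) sw'.
exists (0 + 4 * (`|e| * K1 + K2)); first by rewrite add0r mulr_ge0 // addr_ge0 // mulr_ge0.
move=> eps he; have := poly_approxD (poly_approxZ e (h1 _ he)) (h2 _ he).
move/poly_approx_derive; apply.
- by rewrite addr_ge0 // mulr_ge0.
- move=> u; pose f s := (s + eps) `^ e * a s.
  pose f' s := (s + eps) `^ e * a' s + a s * (e * (s + eps) `^ (e - 1)).
  have sf : supported f by move=> s hs; rewrite /f sa // mulr0.
  have df s : 0 < s -> is_derive s 1 f (f' s).
    move=> s0; have d1 := da _ s0.
    have d2 : is_derive s 1 (fun s => (s + eps) `^ e) (e * (s + eps) `^ (e - 1) * 1).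
      have -> : (fun s => (s + eps) `^ e) = (fun x : R => x `^ e) \o (@id R + cst eps) by [].
      apply: is_derive1_comp; last by apply: is_derive_eq; rewrite addr0.
      by apply: is_derive1_powR; rewrite ltr_wpDr //; case/andP: he.
    rewrite mulr1 in d2.
    exact: is_deriveM.
  apply: is_derive_eq (is_derive_comp_sq u sf df) _; rewrite /f'; ring.
rewrite sa ?mulr0 ?normr0 //; left.
by rewrite /sq ln0 // oppr0 sqrtr0 lexx invr_gt0 ltr0n.
Unshelve. all: by end_near. Qed.

(** The factor [expR (sq u * sq u)] is [u^-1] for [0 < u < 1]: the multiplier is [u * F u], and it
    is [F] that is approximated. The resulting polynomials in the heat operator then have no
    constant term, for which there would be no kernel bound. *)
Lemma poly_approx_dyadic_symbol S r (h : R -> R) : filter_function h ->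
  exists2 K, 0 <= K & forall eps, 0 <= eps <= 1 ->
    poly_approx S K (fun u => (sq u + eps) `^ r *
      ((h (2^-1 * sq u) - h (sq u)) * expR (sq u * sq u))).
Proof.
move=> [hd _ h1 h0 _]; apply: (@poly_approx_symbol S
  (fun s => (h (2^-1 * s) - h s) * expR (s * s)) r).
  apply: smooth_posM; last exact: smooth_pos_expR_sqr.
  have -> : (fun s => h (2^-1 * s) - h s) =
    (fun s => derive1n 0 h (2^-1 * s) + -1 * derive1n 0 h (1 * s)).
    by apply/funext => s; rewrite /= mul1r mulN1r.
  apply: smooth_posD; first exact: smooth_pos_derive1n.
  by apply: smooth_posM; [exact: smooth_pos_cst|exact: smooth_pos_derive1n].
move=> s [/andP[s0 s2]|s2].
  by rewrite !h1 ?subrr ?mul0r // ger0_norm //; lra.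
by rewrite !h0 ?subrr ?mul0r // ger0_norm //; lra.
Qed.

End CompactlySupportedSymbols.

(** * Integration of bounded measurable functions *)

Section BoundedMeasurable.
Context d {T : measurableType d} {R : realType}.
Variable m : {measure set T -> \bar R}.
Implicit Types (f g : T -> R) (B M : R).

Definition bounded_meas f := measurable_fun setT f /\ exists M, forall x, `|f x| <= M.

Lemma bounded_measD f g : bounded_meas f -> bounded_meas g ->
  bounded_meas (fun x => f x + g x).
Proof.
move=> [mf [M fM]] [mg [M' gM]]; split; first exact: measurable_funD.
by exists (M + M') => x; apply: le_trans (ler_normD _ _) _; apply: lerD.
Qed.

Lemma bounded_measM f g : bounded_meas f -> bounded_meas g ->
  bounded_meas (fun x => f x * g x).
Proof.
move=> [mf [M fM]] [mg [M' gM]]; split; first exact: measurable_funM.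
by exists (M * M') => x; rewrite normrM; apply: ler_pM.
Qed.

Lemma bounded_meas_cst (c : R) : bounded_meas (fun=> c).
Proof. by split; [exact: measurable_cst|exists `|c|]. Qed.

Lemma bounded_measZ (c : R) f : bounded_meas f -> bounded_meas (fun x => c * f x).
Proof. by apply: bounded_measM; exact: bounded_meas_cst. Qed.

Lemma bounded_measB f g : bounded_meas f -> bounded_meas g ->
  bounded_meas (fun x => f x - g x).
Proof.
move=> bf /(bounded_measZ (-1)) bg.
rewrite (_ : (fun _ => _) = fun x => f x + -1 * g x); first exact: bounded_measD.
by apply/funext => x; rewrite mulN1r.
Qed.

Lemma bounded_meas_norm f : bounded_meas f -> bounded_meas (fun x => `|f x|).
Proof.
move=> [mf [M fM]]; split; first exact: measurableT_comp.
by exists M => x; rewrite normr_id.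
Qed.

Lemma bounded_measX f k : bounded_meas f -> bounded_meas (fun x => f x ^+ k).
Proof.
move=> bf; elim: k => [|k IH]; first exact: (bounded_meas_cst 1).
rewrite (_ : (fun _ => _) = fun x => f x * f x ^+ k); first exact: bounded_measM.
by apply/funext => x; rewrite exprS.
Qed.

Lemma bounded_meas_sum (I : Type) (s : seq I) (F : I -> T -> R) :
  (forall i, bounded_meas (F i)) -> bounded_meas (fun x => \sum_(i <- s) F i x).
Proof.
move=> bF; elim: s => [|i s IH].
  under eq_fun do rewrite big_nil; exact: bounded_meas_cst.
under eq_fun do rewrite big_cons; exact: bounded_measD.
Qed.

Lemma bounded_meas_indic (E : set T) : measurable E -> bounded_meas (\1_E : T -> R).
Proof.
move=> mE; split; first exact: measurable_indic.
by exists 1 => x; rewrite indicE; case: (_ \in _); rewrite ?normr1 ?normr0.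
Qed.

Hypothesis mfin : (m setT < +oo)%E.

Lemma bounded_meas_integrable f : bounded_meas f -> m.-integrable setT (EFin \o f).
Proof.
move=> [mf [M fM]]; apply: measurable_bounded_integrable => //.
exists M; split; first exact: num_real.
by move=> x xM y _; apply: le_trans (fM y) _; exact: ltW.
Qed.
#[local] Hint Resolve bounded_meas_integrable : core.

Local Notation I f := (\int[m]_x f x).

Lemma RintegralE f : bounded_meas f -> (\int[m]_x (f x)%:E = (I f)%:E)%E.
Proof.
move=> bf; rewrite /Rintegral fineK //; apply: integrable_fin_num => //.
exact: bounded_meas_integrable.
Qed.

Lemma bounded_meas_Rintegral_sum (J : Type) (s : seq J) (F : J -> T -> R) :
  (forall i, bounded_meas (F i)) ->
  \int[m]_x (\sum_(i <- s) F i x) = \sum_(i <- s) I (F i).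
Proof.
move=> bF; elim: s => [|i s IH].
  by under eq_fun do rewrite big_nil; rewrite big_nil Rintegral_cst // mul0r.
under eq_fun do rewrite big_cons; rewrite big_cons -IH RintegralD //.
  exact: bounded_meas_integrable.
by apply: bounded_meas_integrable; exact: bounded_meas_sum.
Qed.

Lemma bounded_meas_le f g : bounded_meas f -> bounded_meas g ->
  (forall x, f x <= g x) -> I f <= I g.
Proof.
by move=> bf bg fg; apply: le_Rintegral => //; exact: bounded_meas_integrable.
Qed.

Lemma bounded_meas_RintegralD f g : bounded_meas f -> bounded_meas g ->
  \int[m]_x (f x + g x) = I f + I g.
Proof. by move=> bf bg; rewrite RintegralD //; exact: bounded_meas_integrable. Qed.

Lemma bounded_meas_RintegralZ (c : R) f : bounded_meas f ->
  \int[m]_x (c * f x) = c * I f.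
Proof. by move=> bf; rewrite RintegralZl //; exact: bounded_meas_integrable. Qed.

Lemma bounded_meas_Rintegral_norm f : bounded_meas f ->
  `|I f| <= \int[m]_x `|f x|.
Proof. by move=> bf; apply: le_normr_Rintegral => //; exact: bounded_meas_integrable. Qed.

Lemma Rintegral_indic_fine (E : set T) : measurable E -> I (\1_E) = fine (m E).
Proof. by move=> mE; rewrite /Rintegral integral_indic // setIT. Qed.

Lemma bounded_meas_cvg (S : nat -> T -> R) g M : (forall n, measurable_fun setT (S n)) ->
  (forall x, S n x @[n --> \oo] --> g x) -> (forall x, `|g x| <= M) -> bounded_meas g.
Proof.
move=> mS Sg gM; split; last by exists M.
by apply: (measurable_fun_cvg mS) => x _; exact: Sg.
Qed.

Lemma Rintegral_sqr_cvg (S : nat -> T -> R) g B : (forall n, bounded_meas (S n)) ->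
  bounded_meas g -> (forall x, S n x @[n --> \oo] --> g x) ->
  (forall n, \int[m]_x (S n x ^+ 2) <= B) -> \int[m]_x (g x ^+ 2) <= B.
Proof.
move=> bS bg Sg IS; rewrite -lee_fin -RintegralE; last exact: bounded_measX.
have := @fatou _ _ _ m setT measurableT (fun n x => (S n x ^+ 2)%:E) _ _.
have h1 n : measurable_fun setT (fun x => (S n x ^+ 2)%:E).
  by apply/measurable_EFinP; case: (bounded_measX 2 (bS n)).
have h2 n x : setT x -> (0 <= (S n x ^+ 2)%:E)%E by rewrite lee_fin sqr_ge0.
move=> /(_ h1 h2).
have -> : (\int[m]_x limn_einf (fun n => (S n x ^+ 2)%:E) = \int[m]_x (g x ^+ 2)%:E)%E.
  apply: eq_integral => x _; have cv : (fun n => (S n x ^+ 2)%:E) @ \oo --> (g x ^+ 2)%:E.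
    apply: cvg_EFin; first exact: nearW.
    by rewrite expr2; under eq_fun do rewrite expr2; apply: cvgM; exact: Sg.
  by rewrite (cvg_limn_einf_sup cv).1.
move/le_trans; apply.
have -> : (fun n => \int[m]_x (S n x ^+ 2)%:E)%E = (fun n => (\int[m]_x (S n x ^+ 2))%:E).
  by apply/funext => n; apply: RintegralE; exact: bounded_measX.
rewrite limn_einf_lim; apply: lime_le; first exact: is_cvg_einfs.
apply: nearW => n; apply: (@le_trans _ _ (\int[m]_x (S n x ^+ 2))%:E); last by rewrite lee_fin.
by apply: ereal_inf_lbound; exists n => /=.
Qed.

(** * Expansions in an orthonormal system *)

Variable phi : nat -> T -> R.
Hypothesis bphi : forall k, bounded_meas (phi k).
Hypothesis orth : forall j k, \int[m]_x (phi j x * phi k x) = (j == k)%:R.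

Lemma bounded_meas_comb J (b : nat -> R) :
  bounded_meas (fun x => \sum_(j < J) b j * phi j x).
Proof. by apply: bounded_meas_sum => j; exact: bounded_measZ. Qed.

Lemma Rintegral_comb_phi J (b : nat -> R) k :
  \int[m]_x ((\sum_(j < J) b j * phi j x) * phi k x) = if (k < J)%N then b k else 0.
Proof.
under eq_fun do rewrite mulr_suml.
rewrite bounded_meas_Rintegral_sum; last first.
  by move=> j; apply: bounded_measM => //; exact: bounded_measZ.
have E (j : 'I_J) : true -> \int[m]_x (b j * phi j x * phi k x) =
    if (j : nat) == k then b j else 0.
  move=> _; under eq_fun do rewrite -mulrA.
  rewrite bounded_meas_RintegralZ ?orth; last exact: bounded_measM.
  by case: eqP; rewrite ?mulr1 ?mulr0.
rewrite (eq_bigr _ E) -big_mkcond /=; case: ifP => kJ.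
  by rewrite (big_pred1 (Ordinal kJ)).
by rewrite big_pred0 // => j; apply/negP => /eqP jk; move: (ltn_ord j); rewrite jk kJ.
Qed.

Lemma Rintegral_comb_sqr J (b : nat -> R) :
  \int[m]_x ((\sum_(j < J) b j * phi j x) ^+ 2) = \sum_(j < J) b j ^+ 2.
Proof.
have E x : (\sum_(j < J) b j * phi j x) ^+ 2 =
    \sum_(j < J) b j * ((\sum_(k < J) b k * phi k x) * phi j x).
  by rewrite expr2 mulr_suml; apply: eq_bigr => j _; ring.
under eq_fun do rewrite E.
rewrite bounded_meas_Rintegral_sum; last first.
  by move=> j; apply: bounded_measZ; apply: bounded_measM => //; exact: bounded_meas_comb.
apply: eq_bigr => j _; rewrite bounded_meas_RintegralZ; last first.
  by apply: bounded_measM => //; exact: bounded_meas_comb.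
by rewrite Rintegral_comb_phi ltn_ord.
Qed.

Lemma Rintegral_sqr_series_le (b : nat -> R) g B : bounded_meas g ->
  (forall y, \sum_(j < n) b j * phi j y @[n --> \oo] --> g y) ->
  (forall n, \sum_(j < n) b j ^+ 2 <= B) -> \int[m]_x (g x ^+ 2) <= B.
Proof.
move=> bg bcvg bB.
apply: (@Rintegral_sqr_cvg (fun n x => \sum_(j < n) b j * phi j x)) => // n.
  exact: bounded_meas_comb.
by rewrite Rintegral_comb_sqr.
Qed.

End BoundedMeasurable.

(** * Kernels of multipliers *)

Lemma cvg_sumr {R : realType} n (f : 'I_n -> nat -> R) (l : 'I_n -> R) :
  (forall i, f i k @[k --> \oo] --> l i) ->
  \sum_(i < n) f i k @[k --> \oo] --> \sum_(i < n) l i.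
Proof.
elim: n f l => [f l _|n IH f l fl].
  by rewrite big_ord0; under eq_fun do rewrite big_ord0; exact: cvg_cst.
rewrite big_ord_recr; under eq_fun do rewrite big_ord_recr.
by apply: cvgD; [apply: IH => i|]; exact: fl.
Qed.

Definition mult_kernel {R : realType} {T : Type} (phi : nat -> T -> R) (J : nat)
  (M : nat -> R) (x y : T) : R := \sum_(j < J) M j * phi j x * phi j y.

Section KernelEstimate.
Context d {T : measurableType d} {R : realType}.
Variables (m : {measure set T -> \bar R}) (rho : T -> T -> R).
Variables (lam : nat -> R) (phi : nat -> T -> R) (q kappa2 kappa3 kappa4 : R).
Implicit Types (N t : R) (x y : T) (i j k J S b : nat) (M : nat -> R).
Hypothesis m1 : m setT = 1%E.
Hypothesis mrho : forall x, measurable_fun setT (rho x).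
Hypothesis rho_ge0 : forall x y, 0 <= rho x y.
Hypothesis rhoxx : forall x, rho x x = 0.
Hypothesis bphi : forall k, bounded_meas (phi k).
Hypothesis orth : forall j k, \int[m]_x (phi j x * phi k x) = (j == k)%:R.
Hypothesis q_gt0 : 0 < q.
Hypothesis kappa2_gt0 : 0 < kappa2.
Hypothesis kappa3_gt0 : 0 < kappa3.
Hypothesis kappa4_gt0 : 0 < kappa4.
Hypothesis ball_measure : forall x (r : R), 0 < r ->
  (m [set y | rho x y <= r]%R <= (kappa2 * r `^ q)%:E)%E.
Hypothesis heat_cvg : forall (t : R) x y, 0 < t <= 1 ->
  cvgn (heat_series lam phi t x y).
Hypothesis heat_bound : forall (t : R) x y, 0 < t <= 1 ->
  `|heat_kernel lam phi t x y| <=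
    kappa3 * t `^ (- (q / 2)) * expR (- (kappa4 * rho x y ^+ 2 / t)).

Let mfin : (m setT < +oo)%E. Proof. by rewrite m1 ltry. Qed.

(** Eigenvalues of the heat operator at time [N ^- 2]; the power [i.+1] corresponds to time
    [i.+1 / N ^+ 2]. *)
Let u (N : R) j := expR (- (lam j / N) ^+ 2).

Lemma heat_node01 N j : 0 <= u N j <= 1.
Proof. by rewrite expR_ge0 /= -expR0 ler_expR oppr_le0 sqr_ge0. Qed.

Lemma heat_seriesE N i x y J : N != 0 ->
  heat_series lam phi (i.+1%:R / N ^+ 2) x y J =
  \sum_(j < J) u N j * u N j ^+ i * phi j x * phi j y.
Proof.
move=> N0; rewrite /heat_series /series /= big_mkord; apply: eq_bigr => j _.
congr (_ * _ * _); rewrite /u -exprS -expRM_natl; congr expR.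
by field.
Qed.

Lemma heat_time N i : 1 <= N -> i.+1%:R <= N ^+ 2 -> 0 < i.+1%:R / N ^+ 2 <= 1.
Proof.
move=> N1 iN; have N0 : 0 < N ^+ 2 by rewrite exprn_gt0 // (lt_le_trans _ N1).
by rewrite divr_gt0 ?ltr0n //= ler_pdivrMr // mul1r.
Qed.

Lemma heat_time_powR N i : 1 <= N -> (i.+1%:R / N ^+ 2) `^ (- (q / 2)) <= N `^ q.
Proof.
move=> N1; have N0 : 0 < N by exact: lt_le_trans N1.
have -> : N `^ q = (N ^- 2) `^ (- (q / 2)).
  by rewrite -powR_invn ?ltW // -powRrM; congr powR; field.
have h : 0 < N ^- 2 by rewrite invr_gt0 exprn_gt0.
have h' : N ^- 2 <= i.+1%:R / N ^+ 2 by apply: ler_peMl; [exact: ltW|rewrite ler1n].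
rewrite !powRN lef_pV2 ?posrE ?powR_gt0 //; last exact: lt_le_trans h'.
apply: ge0_ler_powR; rewrite ?nnegrE.
- by rewrite divr_ge0 // ltW.
- exact: ltW.
- by apply: le_trans h'; exact: ltW.
- exact: h'.
Qed.

(** The left side is a partial sum of the heat series on the diagonal, where all terms are
    nonnegative. *)
Lemma christoffel_bound N x J : 1 <= N ->
  \sum_(j < J) u N j * phi j x ^+ 2 <= kappa3 * N `^ q.
Proof.
move=> N1; have N0 : N != 0 by rewrite gt_eqF // (lt_le_trans _ N1).
have t01 : 0 < 1%:R / N ^+ 2 <= 1 by apply: (@heat_time N 0) => //; exact: exprn_ege1.
have := heat_bound x x t01; rewrite rhoxx expr0n mulr0 mul0r oppr0 expR0 mulr1.
move=> hb; have : heat_kernel lam phi (1%:R / N ^+ 2) x x <= kappa3 * N `^ q.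
  apply: le_trans (ler_norm _) _; apply: le_trans hb _.
  by rewrite ler_pM2l //; exact: (@heat_time_powR N 0).
move=> hk; apply: le_trans hk.
have -> : \sum_(j < J) u N j * phi j x ^+ 2 = heat_series lam phi (1%:R / N ^+ 2) x x J.
  by rewrite (heat_seriesE 0) //; apply: eq_bigr => j _; rewrite expr0 mulr1 -mulrA expr2.
apply: nondecreasing_cvgn_le; last exact: heat_cvg.
apply/nondecreasing_seqP => n.
rewrite !(heat_seriesE 0) // big_ord_recr /= lerDl expr0 mulr1 -mulrA.
by rewrite mulr_ge0 ?expR_ge0 // -expr2 sqr_ge0.
Qed.

Lemma bounded_meas_mult_kernel J M x : bounded_meas (mult_kernel phi J M x).
Proof. exact: (bounded_meas_comb bphi J (fun j => M j * phi j x)). Qed.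

Lemma bounded_meas_heat t x : 0 < t <= 1 -> bounded_meas (heat_kernel lam phi t x).
Proof.
move=> t01; apply: (@bounded_meas_cvg _ _ _ (fun n y => heat_series lam phi t x y n)
   _ (kappa3 * t `^ (- (q / 2)))).
- move=> n; rewrite (_ : (fun y => _) =
    fun y => \sum_(j < n) expR (- (lam j ^+ 2 * t)) * phi j x * phi j y).
    by have [] := bounded_meas_comb bphi n (fun j => expR (- (lam j ^+ 2 * t)) * phi j x).
  by apply/funext => y; rewrite /heat_series /series /= big_mkord.
- by move=> y; exact: heat_cvg.
move=> y; apply: le_trans (heat_bound x y t01) _.
rewrite ler_piMr ?mulr_ge0 ?powR_ge0 ?(ltW kappa3_gt0) // -expR0 ler_expR oppr_le0.
by case/andP: t01 => t0 _; rewrite divr_ge0 ?(ltW t0) // mulr_ge0 ?sqr_ge0 // ltW.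
Qed.

(* Off-diagonal decay: [(k + S).+1] heat times at distance [C0 k / N]. *)
Lemma heat_gauss N S k i x y (C0 : R) : 1 <= N -> (k + S).+1%:R <= N ^+ 2 ->
  kappa4 * C0 ^+ 2 = 3 * S.+2%:R -> 0 <= C0 -> C0 * k%:R / N <= rho x y -> (i < (k + S).+1)%N ->
  `|heat_kernel lam phi (i.+1%:R / N ^+ 2) x y| <= kappa3 * N `^ q * expR (- (3 * k%:R)).
Proof.
move=> N1 kN hC C0ge yk ik; have N0 : 0 < N by exact: lt_le_trans N1.
have iN : i.+1%:R <= N ^+ 2 by apply: le_trans kN; rewrite ler_nat.
apply: le_trans (heat_bound x y (heat_time N1 iN)) _.
apply: ler_pM; rewrite ?mulr_ge0 ?powR_ge0 ?expR_ge0 ?(ltW kappa3_gt0) //.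
  by rewrite ler_pM2l // heat_time_powR.
rewrite ler_expR lerN2.
have h1 : (C0 * k%:R / N) ^+ 2 <= rho x y ^+ 2.
  by rewrite ler_sqr ?nnegrE // !mulr_ge0 // invr_ge0 ltW.
have -> : kappa4 * rho x y ^+ 2 / (i.+1%:R / N ^+ 2) =
  kappa4 * (rho x y ^+ 2 * N ^+ 2) / i.+1%:R.
  by field; rewrite (gt_eqF N0) addrC natr1 pnatr_eq0.
have h2 : C0 ^+ 2 * k%:R ^+ 2 <= rho x y ^+ 2 * N ^+ 2.
  by rewrite -exprMn -ler_pdivrMr ?exprn_gt0 // -expr_div_n.
rewrite ler_pdivlMr ?ltr0n //.
apply: (@le_trans _ _ (kappa4 * (C0 ^+ 2 * k%:R ^+ 2))); last by rewrite ler_pM2l.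
(* What remains is [k * i.+1 <= S.+2 * k ^ 2]: for [k >= 1], [i.+1 <= k + S + 1 <= S.+2 * k]. This
   is the reason for the value of [C0]. *)
rewrite mulrA hC -!mulrA ler_pM2l // -!natrM -?natrX -?natrM ler_nat.
apply: (@leq_trans (k * (k + S).+1)); first by rewrite leq_mul2l ik orbT.
case: (k) => // k'; rewrite expnS expn1 mulnCA leq_mul2l /= mulnS.
by rewrite addSn -!addnS addnC leq_add2l leq_pmull.
Qed.

(* [F] is replaced by a polynomial in the heat operator: the polynomial part is
   Gaussian off the diagonal, the error is small in L^2. *)
Lemma region_bound N J b k x (M : nat -> R) F (K C0 V : R) (E : set T) :
  1 <= N -> (k + 2 * b.+2).+1%:R <= N ^+ 2 ->
  kappa4 * C0 ^+ 2 = 3 * (2 * b.+2).+2%:R -> 0 <= C0 ->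
  0 <= K -> poly_approx (2 * b.+2) K F ->
  (forall j, u N j * F (u N j) = M j) -> (forall j, (J <= j)%N -> M j = 0) ->
  measurable E -> (forall y, E y -> C0 * k%:R / N <= rho x y) ->
  (m E <= (V * N `^ (- q) * k.+1%:R ^+ b)%:E)%E ->
  \int[m]_y (\1_E y * `|mult_kernel phi J M x y|) <=
    (K * kappa3 * V * (b.+2%:R ^+ b.+2 * expR 1) + (K ^+ 2 * kappa3 + V) / 2) *
    k.+1%:R ^- 2.
Proof.
move=> N1 kN hC C0ge K0 appF uF MJ mE Ek EV.
have N0 : 0 < N by exact: lt_le_trans N1.
set S := (2 * b.+2)%N in kN hC appF *.
set z : R := k.+1%:R; have z1 : 1 <= z by rewrite ler1n.
have z0 : 0 < z by exact: lt_le_trans z1.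
set L := N `^ q; have L0 : 0 < L by rewrite powR_gt0.
have LV : N `^ (- q) = L^-1 by rewrite powRN.
have [Q [c cK QE] Qe] := appF k.
pose n := (k + S).+1.
have tn (i : 'I_n) : 0 < i.+1%:R / N ^+ 2 <= 1.
  by apply: heat_time => //; apply: le_trans kN; rewrite ler_nat.
pose gQ y := \sum_(i < n) c i * heat_kernel lam phi (i.+1%:R / N ^+ 2) x y.
have bgQ : bounded_meas gQ.
  apply: bounded_meas_sum => i; apply: bounded_measZ.
  exact: bounded_meas_heat.
have bkM := bounded_meas_mult_kernel J M x.
have bI : bounded_meas (\1_E : T -> R) by exact: bounded_meas_indic.
pose D y := mult_kernel phi J M x y - gQ y.
have bD : bounded_meas D by exact: bounded_measB.
have V0 : 0 <= V.
  have := le_trans (measure_ge0 m E) EV; rewrite lee_fin LV.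
  by rewrite pmulr_lge0 ?exprn_gt0 // pmulr_lge0 // invr_gt0.
have IE : \int[m]_y (\1_E y) <= V * L^-1 * z ^+ b.
  rewrite Rintegral_indic_fine // -LV -lee_fin fineK // ge0_fin_numE //.
  by apply: le_lt_trans EV _; rewrite ltry.
have gQE y : E y -> `|gQ y| <= K * kappa3 * L * expR (- k%:R).
  (* The decay absorbs the size of the coefficients, as [3 <= expR 2]. *)
  move=> Ey; have e3 : 3 ^+ k * expR (- (3 * k%:R)) <= expR (- k%:R) :> R.
    have -> : - (3 * k%:R) = k%:R * (- 2) - k%:R :> R by ring.
    rewrite expRD mulrA ler_piMl ?expR_ge0 // expRM_natl -exprMn.
    apply: exprn_ile1; first by apply: mulr_ge0 => //; exact: expR_ge0.
    by rewrite expRN ler_pdivrMr ?expR_gt0 // mul1r; have := @expR_ge1Dx R 2; lra.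
  apply: (@le_trans _ _ (K * 3 ^+ k * (kappa3 * L * expR (- (3 * k%:R))))); last first.
    rewrite (_ : K * _ * _ = K * kappa3 * L * (3 ^+ k * expR (- (3 * k%:R)))); last by ring.
    by apply: ler_wpM2l => //; rewrite !mulr_ge0 // ltW.
  apply: le_trans (ler_norm_sum _ _ _) _.
  apply: (@le_trans _ _ (\sum_(i < n) `|c i| * (kappa3 * L * expR (- (3 * k%:R))))).
    apply: ler_sum => i _; rewrite normrM; apply: ler_wpM2l => //.
    exact: (heat_gauss N1 kN hC C0ge (Ek _ Ey)).
  rewrite -mulr_suml; apply: ler_wpM2r => //.
  by rewrite !mulr_ge0 ?expR_ge0 // ltW.
have gauss : \int[m]_y (\1_E y * `|gQ y|) <=
    K * kappa3 * V * (b.+2%:R ^+ b.+2 * expR 1) * z ^- 2.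
  have A0 : 0 <= K * kappa3 * L * expR (- k%:R).
    by rewrite !mulr_ge0 ?expR_ge0 // ltW.
  have pt y : \1_E y * `|gQ y| <= K * kappa3 * L * expR (- k%:R) * \1_E y.
    rewrite indicE; have [/set_mem/gQE Ey|_] := boolP (y \in E).
      by rewrite mul1r mulr1.
    by rewrite mul0r mulr0.
  apply: le_trans (bounded_meas_le mfin _ _ pt) _.
  - by apply: bounded_measM => //; exact: bounded_meas_norm.
  - exact: bounded_measZ.
  rewrite bounded_meas_RintegralZ //; apply: le_trans (ler_wpM2l A0 IE) _.
  rewrite (_ : _ * (V * _ * _) = K * kappa3 * V * (expR (- k%:R) * z ^+ b.+2) * z ^- 2); last first.
    by rewrite -addn2 exprD; field; rewrite !gt_eqF.
  apply: ler_wpM2r; first by rewrite invr_ge0 exprn_ge0 // ltW.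
  apply: ler_wpM2l; first by rewrite !mulr_ge0 // ltW.
  rewrite expRN ler_pdivrMl ?expR_gt0 // mulrCA -expRD natr1 -/z.
  have b0 : (0 : R) < b.+2%:R by rewrite ltr0n.
  (* Raising [z / b.+2 <= expR (z / b.+2)] to the power [b.+2] gives
     [z ^+ b.+2 <= b.+2 ^+ b.+2 * expR z], with [z = k + 1]. *)
  have -> : z = b.+2%:R * (z / b.+2%:R) by field; rewrite gt_eqF.
  rewrite expRM_natl exprMn; apply: ler_wpM2l; first by rewrite exprn_ge0 // ltW.
  have zb : 0 <= z / b.+2%:R by rewrite divr_ge0 // ltW.
  apply: lerXn2r; rewrite ?nnegrE ?expR_ge0 //.
  by apply: le_trans (expR_ge1Dx _); rewrite lerDr.
set e := K * (Num.sqrt k.+1%:R)^-1 ^+ S in Qe.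
have eE : e ^+ 2 = K ^+ 2 * z ^- (2 * b.+2).
  have hs : (Num.sqrt k.+1%:R)^-1 ^+ S = z^-1 ^+ b.+2.
    by rewrite /S exprM exprVn sqr_sqrtr // ler0n.
  by rewrite /e hs exprMn -exprM mulnC exprVn.
have e0 : 0 <= e by rewrite mulr_ge0 // exprn_ge0 // invr_ge0 sqrtr_ge0.
clearbody e.
(* The coefficients of [D] are [u * (F u - Q u) * phi j x]. Their squares carry [u ^+ 2 <= u], the
   weight of the Christoffel bound, which makes the infinite sum converge. *)
have ID : \int[m]_y (D y ^+ 2) <= e ^+ 2 * (kappa3 * L).
  apply: (Rintegral_sqr_series_le mfin bphi orth
    (b := fun j => (M j - u N j * Q (u N j)) * phi j x)) => //.
    move=> y; pose P J' := \sum_(j < J') M j * phi j x * phi j y -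
      \sum_(i < n) c i * heat_series lam phi (i.+1%:R / N ^+ 2) x y J'.
    have -> : (fun J' => \sum_(j < J') (M j - u N j * Q (u N j)) * phi j x * phi j y) = P.
      apply/funext => J'; rewrite /P.
      under [X in _ - X]eq_bigr do rewrite heat_seriesE ?gt_eqF // mulr_sumr.
      rewrite exchange_big -sumrB; apply: eq_bigr => j _ /=.
      rewrite QE !mulrBl mulr_sumr !mulr_suml; congr (_ - _).
      by apply: eq_bigr => i _; ring.
    apply: cvgB.
      apply: cvg_near_cst.
      exists J => // J' /= JJ'; rewrite /mult_kernel.
      rewrite (big_ord_widen J' (fun j => M j * phi j x * phi j y) JJ').
      rewrite [RHS]big_mkcond /=; apply: eq_bigr => j _; case: ifPn => //.
      by rewrite -leqNgt => /MJ ->; rewrite !mul0r.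
    rewrite /gQ.
    apply: cvg_sumr => i; apply: cvgM; [exact: cvg_cst|exact: heat_cvg].
  move=> J'; apply: (@le_trans _ _ (\sum_(j < J') e ^+ 2 * (u N j * phi j x ^+ 2))).
    apply: ler_sum => j _; rewrite -uF -mulrBr !exprMn [leRHS]mulrA.
    apply: ler_wpM2r; first exact: sqr_ge0.
    have /andP[u0 u1] := heat_node01 N j.
    have h1 : (F (u N j) - Q (u N j)) ^+ 2 <= e ^+ 2.
      rewrite -real_normK ?num_real // ler_sqr ?nnegrE //.
      by apply: Qe; rewrite u0.
    rewrite [leRHS]mulrC; apply: ler_pM; rewrite ?sqr_ge0 //.
    by rewrite expr2; exact: ler_piMr.
  by rewrite -mulr_sumr ler_wpM2l ?sqr_ge0 // christoffel_bound.
have err : \int[m]_y (\1_E y * `|D y|) <= (K ^+ 2 * kappa3 + V) / 2 * z ^- 2.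
  (* Cauchy-Schwarz in the form [|D| <= al / 2 * D ^+ 2 + al^-1 / 2]. This [al] turns the volume
     term into [V * z ^- 2 / 2] and the L^2 term into [K ^+ 2 * kappa3 * z ^- b.+2 / 2]. *)
  pose al := L^-1 * z ^+ b.+2; have al0 : 0 < al by rewrite mulr_gt0 ?invr_gt0 // exprn_gt0.
  have pt y : \1_E y * `|D y| <= al / 2 * D y ^+ 2 + al^-1 / 2 * \1_E y.
    rewrite indicE; have [_|_] := boolP (y \in E); last first.
      by rewrite mul0r mulr0 addr0 mulr_ge0 ?sqr_ge0 // divr_ge0 // ltW.
    rewrite mul1r mulr1 -[D y ^+ 2]real_normK ?num_real // -subr_ge0.
    rewrite (_ : _ - _ = (al * `|D y| - 1) ^+ 2 / (2 * al)).
      by rewrite divr_ge0 ?sqr_ge0 // mulr_ge0 // ltW.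
    by field; rewrite gt_eqF.
  apply: le_trans (bounded_meas_le mfin _ _ pt) _.
  - by apply: bounded_measM => //; exact: bounded_meas_norm.
  - by apply: bounded_measD; apply: bounded_measZ => //; exact: bounded_measX.
  rewrite bounded_meas_RintegralD //; last 2 first.
  - by apply: bounded_measZ; exact: bounded_measX.
  - exact: bounded_measZ.
  rewrite !bounded_meas_RintegralZ //; last exact: bounded_measX.
  apply: (@le_trans _ _ (al / 2 * (e ^+ 2 * (kappa3 * L)) + al^-1 / 2 * (V * L^-1 * z ^+ b))).
    by apply: lerD; apply: ler_wpM2l; rewrite // divr_ge0 ?invr_ge0 // ltW.
  rewrite eE mulnC exprM.
  rewrite [leLHS](_ : _ = (K ^+ 2 * kappa3 * z ^- b.+2 + V * z ^- 2) / 2).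
    rewrite [leRHS](_ : _ = (K ^+ 2 * kappa3 * z ^- 2 + V * z ^- 2) / 2); last first.
      by field; rewrite gt_eqF.
    apply: ler_wpM2r => //; apply: lerD => //; apply: ler_wpM2l.
      by rewrite mulr_ge0 ?sqr_ge0 // ltW.
    by rewrite lef_pV2 ?posrE ?exprn_gt0 // ler_weXn2l.
  rewrite /al -[b.+2]addn2 exprD; field.
  by rewrite !gt_eqF // exprn_gt0.
have ptk y : \1_E y * `|mult_kernel phi J M x y| <= \1_E y * `|gQ y| + \1_E y * `|D y|.
  rewrite -mulrDr; apply: ler_wpM2l; first by rewrite indicE; case: (_ \in _).
  by rewrite (le_trans _ (ler_normD _ _)) // /D addrC subrK.
have bg : bounded_meas (fun y => \1_E y * `|gQ y|).
  by apply: bounded_measM => //; exact: bounded_meas_norm.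
have bd : bounded_meas (fun y => \1_E y * `|D y|).
  by apply: bounded_measM => //; exact: bounded_meas_norm.
have bk : bounded_meas (fun y => \1_E y * `|mult_kernel phi J M x y|).
  by apply: bounded_measM => //; exact: bounded_meas_norm.
apply: le_trans (bounded_meas_le mfin bk (bounded_measD bg bd) ptk) _.
rewrite bounded_meas_RintegralD // mulrDl; exact: lerD.
Qed.

Let annulus (C0 N : R) x k := [set y | C0 * k%:R / N <= rho x y <= C0 * k.+1%:R / N].
Let far (C0 N : R) x k := [set y | C0 * k%:R / N <= rho x y].

Let measurable_far C0 N x k : measurable (far C0 N x k).
Proof.
rewrite /far (_ : [set _ | _] = setT `&` rho x @^-1` `[C0 * k%:R / N, +oo[).
  exact: mrho.
by apply/seteqP; split => y /=; rewrite in_itv /= andbT // => -[].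
Qed.

Let measurable_annulus C0 N x k : measurable (annulus C0 N x k).
Proof.
rewrite /annulus (_ : [set _ | _] =
  setT `&` rho x @^-1` `[C0 * k%:R / N, C0 * k.+1%:R / N]); first exact: mrho.
by apply/seteqP; split => y /=; rewrite in_itv /= // => -[].
Qed.

Lemma annuli_cover C0 N x n y : 
  1 <= \sum_(k < n) (\1_(annulus C0 N x k) y : R) + \1_(far C0 N x n) y.
Proof.
elim: n => [|n IH].
  by rewrite big_ord0 add0r indicE mem_set //= /far /= mulr0 mul0r.
apply: le_trans IH _; rewrite big_ord_recr /= -addrA lerD2l !indicE.
have [/set_mem/= fn|_] := boolP (y \in far C0 N x n); last by rewrite addr_ge0.
have [h|h] := leP (rho x y) (C0 * n.+1%:R / N).
  by rewrite (@mem_set _ (annulus C0 N x n)) ?lerDl //=; apply/andP.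
by rewrite (@mem_set _ (far C0 N x n.+1)) ?lerDr //= /far /= ltW.
Qed.

Lemma sum_inv_sqr_le n : \sum_(k < n.+1) (k.+1%:R ^- 2 : R) <= 2 - n.+1%:R^-1.
Proof.
elim: n => [|n IH]; first by rewrite big_ord1 expr1n invr1; lra.
rewrite big_ord_recr /=; apply: le_trans (lerD IH (lexx _)) _.
rewrite -subr_ge0; set a : R := n.+1%:R.
have a0 : 0 < a by rewrite ltr0n.
have -> : n.+2%:R = a + 1 :> R by rewrite natr1.
have -> : 2 - (a + 1)^-1 - (2 - a^-1 + (a + 1) ^- 2) = (a * (a + 1) ^+ 2)^-1.
  by field; rewrite !gt_eqF // addr_gt0.
by rewrite invr_ge0 mulr_ge0 ?sqr_ge0 // ltW.
Qed.

(** [region_bound] on the [k]-th annulus costs a multiple of [k.+1 ^- 2], which is summable. The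
    degree used is tied to the distance: close to [x] a crude approximation suffices, because the
    volume is small. *)
Lemma mult_kernel_L1 b (K : R) : q <= b%:R -> 0 <= K -> exists2 C : R, 0 <= C &
  forall N J x M F, 1 <= N -> (2 * b.+2).+1%:R <= N ^+ 2 ->
    poly_approx (2 * b.+2) K F -> (forall j, u N j * F (u N j) = M j) ->
    (forall j, (J <= j)%N -> M j = 0) ->
    \int[m]_y `|mult_kernel phi J M x y| <= C.
Proof.
move=> qb K0; set S := (2 * b.+2)%N.
pose C0 : R := Num.sqrt (3 * S.+2%:R / kappa4).
have C0ge : 0 < C0 by rewrite sqrtr_gt0 divr_gt0 // mulr_gt0 // ltr0n.
have hC : kappa4 * C0 ^+ 2 = 3 * S.+2%:R.
  rewrite sqr_sqrtr; first by field; rewrite gt_eqF.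
  by rewrite divr_ge0 ?mulr_ge0 // ltW.
(* The first summand serves the annuli, the second the far region. *)
pose V := kappa2 * C0 `^ q + S.+2%:R ^+ b.
have V0 : 0 <= V by rewrite addr_ge0 ?exprn_ge0 // mulr_ge0 ?powR_ge0 // ltW.
pose C := K * kappa3 * V * (b.+2%:R ^+ b.+2 * expR 1) + (K ^+ 2 * kappa3 + V) / 2.
have Cge : 0 <= C.
  apply: addr_ge0; first apply: mulr_ge0.
  - by apply: mulr_ge0 => //; apply: mulr_ge0 => //; exact: ltW.
  - by apply: mulr_ge0; [exact: exprn_ge0|exact: expR_ge0].
  by rewrite divr_ge0 // addr_ge0 // mulr_ge0 ?sqr_ge0 // ltW.
exists (C * 2); first by rewrite mulr_ge0.
move=> N J x M F N1 SN appF uF MJ.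
have N0 : 0 < N by exact: lt_le_trans N1.
have NqV : 0 < N `^ (- q) by rewrite powR_gt0.
(* The last [k] for which all heat times up to [(k + S).+1 / N ^+ 2] are at most 1. *)
pose n := (Num.truncn (N ^+ 2) - S.+1)%N.
have N2 : 0 <= N ^+ 2 by rewrite sqr_ge0.
have /andP[tr1 tr2] := truncn_itv N2.
have St : (S.+1 <= Num.truncn (N ^+ 2))%N by rewrite truncn_ge_nat.
have nE : (n + S.+1)%N = Num.truncn (N ^+ 2) by rewrite subnK.
have kN k : (k <= n)%N -> (k + S).+1%:R <= N ^+ 2.
  by move=> kn; apply: le_trans tr1; rewrite ler_nat -nE addnS ltnS leq_add2r.
have zq k : k.+1%:R `^ q <= k.+1%:R ^+ b :> R.
  by rewrite -powR_mulrn // ler_powR // ler1n.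
have ann k : (k < n)%N -> \int[m]_y (\1_(annulus C0 N x k) y * `|mult_kernel phi J M x y|)
    <= C * k.+1%:R ^- 2.
  move=> kn; apply: (@region_bound N J b k x M F K C0 V) => //.
  - by apply: kN; exact: ltnW.
  - exact: ltW.
  - by move=> y /andP[].
  have r0 : 0 < C0 * k.+1%:R / N by rewrite divr_gt0 // mulr_gt0.
  apply: (@le_trans _ _ (m [set y | rho x y <= C0 * k.+1%:R / N]%R)).
    apply: le_measure; rewrite ?inE //; last by move=> y /andP[].
    rewrite (_ : [set _ | _] = setT `&` rho x @^-1` `]-oo, C0 * k.+1%:R / N]).
      exact: mrho.
    by apply/seteqP; split => y /=; rewrite in_itv // => -[].
  apply: le_trans (ball_measure x r0) _; rewrite lee_fin.
  rewrite powRM ?invr_ge0 ?mulr_ge0 ?(ltW C0ge) ?(ltW N0) // powRM ?(ltW C0ge) //.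
  rewrite -[N^-1 `^ q](_ : N `^ (- q) = _); last first.
    by rewrite -powR_inv1 ?ltW // -powRrM mulN1r.
  apply: (@le_trans _ _ (kappa2 * C0 `^ q * N `^ (- q) * k.+1%:R ^+ b)).
    rewrite (_ : _ * (_ * _ * _) = kappa2 * C0 `^ q * N `^ (- q) * k.+1%:R `^ q); last by ring.
    by apply: ler_wpM2l => //; rewrite !mulr_ge0 ?powR_ge0 // ltW.
  apply: ler_wpM2r; first by rewrite exprn_ge0.
  by apply: ler_wpM2r; rewrite ?powR_ge0 // lerDl exprn_ge0.
have fr : \int[m]_y (\1_(far C0 N x n) y * `|mult_kernel phi J M x y|) <= C * n.+1%:R ^- 2.
  apply: (@region_bound N J b n x M F K C0 V) => //.
  - exact: kN.
  - exact: ltW.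
  apply: (@le_trans _ _ (m setT)); first by apply: le_measure; rewrite ?inE.
  rewrite m1 lee_fin.
  rewrite powRN mulrAC ler_pdivlMr ?powR_gt0 // mul1r.
  apply: (@le_trans _ _ (N ^+ 2 ^+ b)).
    apply: (@le_trans _ _ (N ^+ b)); first by rewrite -powR_mulrn ?ler_powR // ltW.
    by apply: lerXn2r; rewrite ?nnegrE ?(ltW N0) // expr2 ler_peMl // ltW.
  apply: (@le_trans _ _ ((S.+2%:R * n.+1%:R) ^+ b)).
    have le2 : N ^+ 2 <= S.+2%:R * n.+1%:R.
      apply: le_trans (ltW tr2) _; rewrite -nE -natrM ler_nat.
      by rewrite -addnS mulnS addnC leq_add2l leq_pmull.
    by apply: lerXn2r => //; rewrite nnegrE (le_trans N2).
  rewrite exprMn; apply: ler_wpM2r; first by rewrite exprn_ge0.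
  by rewrite lerDr mulr_ge0 ?powR_ge0 // ltW.
have bk := bounded_meas_norm (bounded_meas_mult_kernel J M x).
have bA k : bounded_meas (fun y => \1_(annulus C0 N x k) y * `|mult_kernel phi J M x y|).
  by apply: bounded_measM => //; exact: bounded_meas_indic.
have bF : bounded_meas (fun y => \1_(far C0 N x n) y * `|mult_kernel phi J M x y|).
  by apply: bounded_measM => //; exact: bounded_meas_indic.
apply: le_trans (bounded_meas_le mfin (g := fun y =>
  \sum_(k < n) (\1_(annulus C0 N x k) y * `|mult_kernel phi J M x y|) +
  \1_(far C0 N x n) y * `|mult_kernel phi J M x y|) bk _ _) _.
- apply: bounded_measD => //; apply: bounded_meas_sum => k; exact: bA.
- move=> y; rewrite -mulr_suml -mulrDl ler_peMl //; exact: annuli_cover.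
rewrite bounded_meas_RintegralD //; last first.
  by apply: bounded_meas_sum => k; exact: bA.
rewrite bounded_meas_Rintegral_sum //.
apply: (@le_trans _ _ (\sum_(k < n) (C * k.+1%:R ^- 2) + C * n.+1%:R ^- 2)).
  by apply: lerD => //; apply: ler_sum => k _; exact: ann.
rewrite -mulr_sumr -mulrDr; apply: ler_wpM2l => //.
have := sum_inv_sqr_le n; rewrite big_ord_recr /= => /le_trans; apply.
by rewrite gerBl invr_ge0.
Qed.

End KernelEstimate.

(** * The Bernstein inequality *)

Section DataDefinedSpace.
Context {R : realType} {X : ptopologicalType}.
Variables (rho : X -> X -> R) (G : set (set X)).
Variables (mu : probability (g_sigma_algebraType G) R).
Variables (lam : R^nat) (phi : nat -> X -> R) (q : R).
Hypothesis Xi : data_defined_space rho mu lam phi q.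
Implicit Types (x y : X) (N n : R) (j k J : nat) (a M : nat -> R).

Local Notation T := (g_sigma_algebraType G).
Local Notation bm := (@bounded_meas _ T R).
Local Notation I f := (\int[mu]_x (f : T -> R) x).

(** [G'] is arbitrary because [mu] and [nu] live on different sigma-algebras that both contain the
    open sets. *)
Lemma continuous_borel_measurable (G' : set (set X)) (f : X -> R) :
  (open : set (set X)) `<=` <<s G' >> -> continuous f ->
  measurable_fun setT (f : g_sigma_algebraType G' -> R).
Proof.
move=> oG cf; apply: (measurability _ (RGenOpens.measurableE R)).
move=> /= _ [_ [a [b ->]] <-]; rewrite setTI; apply: oG.
by apply: open_comp; [move=> x _; exact: cf|exact: interval_open].
Qed.

Lemma open_oball x (r : R) : open (oball rho x r).
Proof.
have [r0|r0] := ltP 0 r.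
  by have [+ _] := dds_basis Xi; apply; exists x, r.
rewrite (_ : oball rho x r = set0); first exact: open0.
apply/seteqP; split => // y; rewrite /oball /=.
have [k _ [rho0 _ _ _]] := dds_quasi_metric Xi.
by move=> /lt_le_trans/(_ r0); rewrite ltNge rho0.
Qed.

Lemma open_borel : (open : set (set X)) `<=` <<s G >>.
Proof. by have [] := dds_measure Xi. Qed.

Lemma rho_ge0 x y : 0 <= rho x y.
Proof. by have [k _ [rho0 _ _ _]] := dds_quasi_metric Xi. Qed.

Lemma rhoxx x : rho x x = 0.
Proof. by have [k _ [_ rho0 _ _]] := dds_quasi_metric Xi; apply/rho0. Qed.

Lemma measurable_rho (G' : set (set X)) x : (open : set (set X)) `<=` <<s G' >> ->
  measurable_fun setT (rho x : g_sigma_algebraType G' -> R).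
Proof.
move=> oG; apply: (measurability _ (RGenInftyO.measurableE R)).
move=> /= _ [_ [b ->] <-]; rewrite setTI; apply: oG.
rewrite (_ : _ @^-1` _ = oball rho x b); first exact: open_oball.
by apply/seteqP; split => y; rewrite /oball /= in_itv.
Qed.

Lemma measurable_cball (G' : set (set X)) x (e : R) :
  (open : set (set X)) `<=` <<s G' >> ->
  measurable (cball rho x e : set (g_sigma_algebraType G')).
Proof.
move=> oG; rewrite (_ : cball rho x e = setT `&` rho x @^-1` `]-oo, e]).
  exact: (measurable_rho x oG).
by apply/seteqP; split => y; rewrite /cball /= in_itv //= => -[].
Qed.

Lemma mu_setT : mu setT = 1%E. Proof. exact: probability_setT. Qed.

Lemma mu_fin : (mu setT < +oo)%E. Proof. by rewrite mu_setT ltry. Qed.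
#[local] Hint Resolve mu_fin : core.

Lemma bounded_meas_phi j : bm (phi j).
Proof.
split; last exact: dds_phi_bounded Xi j.
by apply: continuous_borel_measurable open_borel _; exact: dds_phi_continuous Xi j.
Qed.
#[local] Hint Resolve bounded_meas_phi : core.

Lemma phi_orthonormal j k : \int[mu]_x (phi j x * phi k x) = (j == k)%:R.
Proof. by rewrite /Rintegral (dds_phi_orthonormal Xi). Qed.

Lemma lam_ge0 j : 0 <= lam j.
Proof. by rewrite -(dds_lam0 Xi); exact: (dds_lam_nd Xi). Qed.

Lemma lam_eventually_ge N : exists J, forall j, (J <= j)%N -> N <= lam j.
Proof.
have /cvgryPge/(_ N)[J _ h] := dds_lam_pinfty Xi.
by exists J => j Jj; exact: h.
Qed.

Lemma lam_cut N : exists J, forall j, (j < J)%N = (lam j < N).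
Proof.
have exP : exists J, N <= lam J.
  by have [J hJ] := lam_eventually_ge N; exists J; exact: hJ.
exists (ex_minn exP) => j; case: ex_minnP => J NJ Jmin; have [jJ|Jj] := ltnP j J.
  by apply/esym; rewrite ltNge; apply/negP => /Jmin; rewrite leqNgt jJ.
by apply/esym; rewrite ltNge (le_trans NJ) // (dds_lam_nd Xi).
Qed.

(** At frequencies up to [N] the heat weight is at least [expR (- 1)], hence the factor [expR 1]. *)
Lemma christoffel : exists2 K, 0 < K & forall N x J, 1 <= N ->
  (forall j, (j < J)%N -> lam j <= N) -> \sum_(j < J) phi j x ^+ 2 <= K * N `^ q.
Proof.
have [k3 [k4 [k30 k40 hb]]] := dds_heat_bound Xi.
exists (expR 1 * k3); first by rewrite mulr_gt0 // expR_gt0.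
move=> N x J N1 lamN; have N0 : 0 < N by exact: lt_le_trans N1.
have := christoffel_bound (T := T) rhoxx (dds_q_gt0 Xi) k30 (dds_heat_cvg Xi) hb x J N1.
rewrite -(ler_pM2l (expR_gt0 1)) !mulrA; apply: le_trans.
rewrite mulr_sumr; apply: ler_sum => j _; rewrite mulrA ler_peMl ?sqr_ge0 //.
rewrite -expRD -[leLHS]expR0 ler_expR subr_ge0 exprn_ile1 ?divr_ge0 ?lam_ge0 ?(ltW N0) //.
by rewrite ler_pdivrMr // mul1r lamN.
Qed.

Lemma kernel_L1 b (K : R) : q <= b%:R -> 0 <= K -> exists2 C : R, 0 <= C &
  forall N J x M F, 1 <= N -> (2 * b.+2).+1%:R <= N ^+ 2 ->
    poly_approx (2 * b.+2) K F ->
    (forall j, expR (- (lam j / N) ^+ 2) * F (expR (- (lam j / N) ^+ 2)) = M j) ->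
    (forall j, (J <= j)%N -> M j = 0) ->
    I (fun y => `|mult_kernel phi J M x y|) <= C.
Proof.
have [k2 k20 hm] := dds_ball_measure Xi.
have [k3 [k4 [k30 k40 hb]]] := dds_heat_bound Xi.
have mr x := measurable_rho x open_borel.
exact: (mult_kernel_L1 (T := T) mu_setT mr rho_ge0 rhoxx bounded_meas_phi phi_orthonormal
  (dds_q_gt0 Xi) k20 k30 k40 hm (dds_heat_cvg Xi) hb).
Qed.

Variables (h : R -> R) (r : R).
Hypothesis hh : filter_function h.
Hypothesis r_gt0 : 0 < r.

Lemma filter01 t : 0 <= t -> 0 <= h t <= 1.
Proof.
have [_ _ h1 h0 hd] := hh => t0.
have h12 : h 2^-1 = 1 by rewrite h1 // ger0_norm.
have h11 : h 1 = 0 by rewrite h0 // normr1.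
have [t1|t1] := leP t 2^-1; first by rewrite h1 ?ler01 ?lexx // ger0_norm.
have [t2|t2] := leP 1 t; first by rewrite h0 ?ler01 ?lexx // ger0_norm.
by apply/andP; split; [rewrite -h11|rewrite -h12]; apply: hd => //; exact: ltW.
Qed.

Lemma filter0 N j : 0 < N -> N <= lam j -> h (lam j / N) = 0.
Proof.
move=> N0 Nl; have [_ _ _ h0 _] := hh; rewrite h0 //.
by rewrite ger0_norm ?divr_ge0 ?lam_ge0 ?(ltW N0) // ler_pdivlMr // mul1r.
Qed.

Lemma dyadic_kernel_L1 : exists N0 C : R, [/\ 1 <= N0, 0 <= C & forall N J x, N0 <= N ->
  (forall j, (J <= j)%N -> 2 * N <= lam j) ->
  I (fun y => `|mult_kernel phi J (fun j =>
      (lam j + 1) `^ r * (h (lam j / (2 * N)) - h (lam j / N))) x y|) <= C * N `^ r].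
Proof.
pose b := (Num.truncn q).+1.
have qb : q <= b%:R by apply: ltW; exact: truncnS_gt.
have [K K0 hK] := poly_approx_dyadic_symbol (2 * b.+2) r hh.
have [C C0 hC] := kernel_L1 qb K0.
(* Frequencies above this [N0] satisfy [(2 * b.+2).+1 <= N ^+ 2], so that even the lowest degree
   uses heat times at most 1. *)
exists (2 * b.+2).+1%:R, C; split => //; first by rewrite ler1n.
move=> N J x N0N lamJ; have N1 : 1 <= N by apply: le_trans N0N; rewrite ler1n.
have N0 : 0 < N by exact: lt_le_trans N1.
pose M j := ((lam j + 1) / N) `^ r * (h (lam j / (2 * N)) - h (lam j / N)).
have e01 : 0 <= N^-1 <= 1 by rewrite invr_ge0 ltW //= invf_le1.
have NN : (2 * b.+2).+1%:R <= N ^+ 2.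
  by apply: le_trans N0N _; rewrite expr2 ler_peMl // ltW.
have uF j : expR (- (lam j / N) ^+ 2) * ((fun u => (Num.sqrt (- ln u) + N^-1) `^ r *
      ((h (2^-1 * Num.sqrt (- ln u)) - h (Num.sqrt (- ln u))) *
        expR (Num.sqrt (- ln u) * Num.sqrt (- ln u))))
    (expR (- (lam j / N) ^+ 2))) = M j.
  rewrite /= expRK opprK sqrtr_sqr ger0_norm; last first.
    by rewrite divr_ge0 ?lam_ge0 // ltW.
  set s := lam j / N; rewrite -expr2 mulrC -2!mulrA -expRD subrr expR0 mulr1 /M.
  by rewrite mulrDl mul1r invfM mulrCA.
have := hC N J x M _ N1 NN (hK _ e01) uF.
have MJ j : (J <= j)%N -> M j = 0.
  move=> /lamJ lj; rewrite /M !filter0 ?subrr ?mulr0 // ?mulr_gt0 //.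
  by apply: le_trans lj; apply: ler_peMl; [exact: ltW|rewrite ler1n].
move=> /(_ MJ) hI.
have -> : (fun y => `|mult_kernel phi J (fun j => (lam j + 1) `^ r *
     (h (lam j / (2 * N)) - h (lam j / N))) x y|) =
   (fun y => N `^ r * `|mult_kernel phi J M x y|).
  apply/funext => y; have E z : N `^ r * `|z| = `|N `^ r * z|.
    by rewrite normrM (ger0_norm (powR_ge0 _ _)).
  rewrite E; congr `|_|.
  rewrite /mult_kernel mulr_sumr; apply: eq_bigr => j _.
  rewrite /M powRM ?addr_ge0 ?lam_ge0 ?invr_ge0 ?(ltW N0) //.
  have -> : N^-1 `^ r = (N `^ r)^-1.
    by rewrite -powR_inv1 ?(ltW N0) // -powRrM mulN1r powRN.
  by field; rewrite gt_eqF // powR_gt0.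
rewrite bounded_meas_RintegralZ //; last first.
  by apply: bounded_meas_norm; exact: bounded_meas_mult_kernel.
by rewrite mulrC ler_wpM2r // powR_ge0.
Qed.

(** The cut-offs [h (lam j / (2 ^+ k * N0))] telescope into dyadic pieces whose L^1 bounds grow like
    [2 ^ (k * r)], so the last one dominates because [r > 0]. The lowest block is bounded pointwise:
    it involves only frequencies below the fixed [N0]. *)
Lemma bernstein_kernel : exists2 C : R, 0 <= C & forall n, 1 <= n ->
  exists M J0, (forall j, lam j < n -> M j = (lam j + 1) `^ r) /\
    forall J x, (J0 <= J)%N -> I (fun y => `|mult_kernel phi J M x y|) <= C * n `^ r.
Proof.
have [N0 [C [N01 C0 hC]]] := dyadic_kernel_L1.
have [K K0 hK] := christoffel.
have N0_gt0 : 0 < N0 by exact: lt_le_trans N01.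
pose Mk k j := (lam j + 1) `^ r * h (lam j / (2 ^+ k * N0)).
pose B := (N0 + 1) `^ r * (K * N0 `^ q).
have B0 : 0 <= B by rewrite mulr_ge0 ?powR_ge0 // mulr_ge0 ?powR_ge0 // ltW.
have bk J M x := bounded_meas_norm (bounded_meas_mult_kernel bounded_meas_phi J M x).
have base J x : (forall j, (J <= j)%N -> N0 <= lam j) ->
    I (fun y => `|mult_kernel phi J (Mk 0%N) x y|) <= B.
  move=> lamJ.
  have [J' lJ'] := lam_cut N0.
  have J'J : (J' <= J)%N by rewrite leqNgt lJ' -leNgt lamJ.
  have pt y : `|mult_kernel phi J (Mk 0%N) x y| <= B.
    have -> : mult_kernel phi J (Mk 0%N) x y = mult_kernel phi J' (Mk 0%N) x y.
      rewrite /mult_kernel (big_ord_widen J (fun j => Mk 0%N j * phi j x * phi j y) J'J).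
      rewrite [RHS]big_mkcond /=; apply: eq_bigr => j _.
      rewrite lJ'; case: ltP => // lj.
      by rewrite /Mk expr0 mul1r filter0 // mulr0 !mul0r.
    have lJ j : (j < J')%N -> lam j <= N0 by rewrite lJ' => /ltW.
    apply: le_trans (ler_norm_sum _ _ _) _.
    apply: (@le_trans _ _ (\sum_(j < J') (N0 + 1) `^ r * ((phi j x ^+ 2 + phi j y ^+ 2) / 2))).
      apply: ler_sum => j _; rewrite -mulrA normrM; apply: ler_pM => //.
        have /andP[h0 h1] : 0 <= h (lam j / (2 ^+ 0 * N0)) <= 1.
          by apply: filter01; rewrite expr0 mul1r divr_ge0 ?lam_ge0 // ltW.
        rewrite ger0_norm ?mulr_ge0 ?powR_ge0 // -[leRHS]mulr1; apply: ler_pM => //.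
          exact: powR_ge0.
        apply: ge0_ler_powR; rewrite ?nnegrE ?(ltW r_gt0) ?addr_ge0 ?lam_ge0 ?(ltW N0_gt0) //.
        by rewrite lerD2r lJ.
      rewrite normrM -[phi j x ^+ 2]real_normK ?num_real // -[phi j y ^+ 2]real_normK ?num_real //.
      by have := sqr_ge0 (`|phi j x| - `|phi j y|); lra.
    rewrite -mulr_sumr; apply: ler_wpM2l; first exact: powR_ge0.
    rewrite -mulr_suml big_split /=.
    have := hK N0 x J' N01 lJ; have := hK N0 y J' N01 lJ; lra.
  apply: le_trans (bounded_meas_le mu_fin (bk _ _ _) (bounded_meas_cst _) pt) _.
  by rewrite Rintegral_cst // [fine _](congr1 fine mu_setT) mulr1.
have r2 : 1 < 2 `^ r :> R.
  rewrite [ltLHS](_ : 1 = 1 `^ r); last by rewrite powR1.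
  by apply: gt0_ltr_powR; rewrite ?nnegrE // ltr1n.
pose C' := B + C / (2 `^ r - 1).
have C'0 : 0 <= C' by rewrite addr_ge0 // divr_ge0 // subr_ge0 ltW.
have step k J x : (forall j, (J <= j)%N -> 2 ^+ k * N0 <= lam j) ->
    I (fun y => `|mult_kernel phi J (Mk k) x y|) <= C' * (2 ^+ k * N0) `^ r.
  elim: k J x => [|k IH] J x lamJ.
    apply: le_trans (base _ _ _) _; first by move=> j /lamJ; rewrite expr0 mul1r.
    rewrite expr0 mul1r; apply: (@le_trans _ _ (C' * 1)).
      by rewrite mulr1 lerDl divr_ge0 // subr_ge0 ltW.
    apply: ler_wpM2l => //; rewrite -[leLHS](powRr0 N0).
    by rewrite ler_powR // ltW.
  set N := 2 ^+ k * N0 in IH *.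
  have N0N : N0 <= N.
    by apply: ler_peMl; [exact: ltW|rewrite exprn_ege1 // ler1n].
  have N_gt0 : 0 < N by exact: lt_le_trans N0N.
  have -> : 2 ^+ k.+1 * N0 = 2 * N by rewrite exprS mulrA.
  have lam2 j : (J <= j)%N -> 2 * N <= lam j by move=> /lamJ; rewrite exprS -mulrA.
  have lam1 j : (J <= j)%N -> N <= lam j.
    by move=> /lam2; apply: le_trans; apply: ler_peMl; [exact: ltW|rewrite ler1n].
  set D := fun j => (lam j + 1) `^ r * (h (lam j / (2 * N)) - h (lam j / N)).
  have pt y : `|mult_kernel phi J (Mk k.+1) x y| <=
     `|mult_kernel phi J (Mk k) x y| + `|mult_kernel phi J D x y|.
    apply: le_trans (ler_normD _ _); rewrite /mult_kernel -big_split /=.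
    rewrite le_eqVlt; apply/orP; left; apply/eqP; congr `|_|.
    apply: eq_bigr => j _; rewrite /Mk /D exprS -!mulrA -/N; ring.
  apply: le_trans (bounded_meas_le mu_fin (bk _ _ _) (bounded_measD (bk _ _ _) (bk _ _ _)) pt) _.
  rewrite bounded_meas_RintegralD //.
  apply: le_trans (lerD (IH _ _ lam1) (hC _ _ _ N0N lam2)) _.
  rewrite powRM // ?(ltW N_gt0) // mulrA -mulrDl; apply: ler_wpM2r; first exact: powR_ge0.
  rewrite /C'; set z := 2 `^ r in r2 *.
  rewrite -subr_ge0 (_ : _ - _ = B * (z - 1)); last by field; rewrite subr_eq0 gt_eqF.
  by rewrite mulr_ge0 // subr_ge0 ltW.
exists (C' * (N0 + 4) `^ r); first by rewrite mulr_ge0 // powR_ge0.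
move=> n n1; have n0 : 0 < n by exact: lt_le_trans n1.
(* With [2 * n] rather than [n], frequencies below [n] fall where [h] is 1. Taking the least such
   [k] keeps the scale comparable to [n]. *)
have [k nk kn] : exists2 k, 2 * n <= 2 ^+ k * N0 & 2 ^+ k * N0 <= (N0 + 4) * n.
  have [k] : exists k, 2 * n <= 2 ^+ k * N0.
    exists (Num.truncn (2 * n)).+1; apply: le_trans (ltW (truncnS_gt _)) _.
    apply: (@le_trans _ _ (2 ^+ (Num.truncn (2 * n)).+1)).
      by rewrite -natrX ler_nat ltnW // ltn_expl.
    by rewrite ler_peMr // exprn_ge0.
  elim: k => [|k IH] hk.
    by exists 0%N => //; rewrite expr0 mul1r; nra.
  have [/IH//|lk] := leP (2 * n) (2 ^+ k * N0).
  by exists k.+1 => //; rewrite exprS; nra.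
have [J0 hJ0] := lam_eventually_ge (2 ^+ k * N0).
exists (Mk k), J0; split.
  move=> j lj; rewrite /Mk; have [_ _ h1 _ _] := hh.
  have p0 : 0 < 2 ^+ k * N0 by rewrite mulr_gt0 // exprn_gt0.
  rewrite h1 ?mulr1 // ger0_norm; last by rewrite divr_ge0 ?lam_ge0 // ltW.
  by rewrite ler_pdivrMr //; lra.
move=> J x J0J; apply: le_trans (step k J x _) _.
  by move=> j Jj; apply: hJ0; exact: leq_trans Jj.
rewrite -mulrA -powRM ?(ltW n0) ?addr_ge0 ?(ltW N0_gt0) //.
apply: ler_wpM2l => //; apply: ge0_ler_powR; rewrite ?nnegrE ?(ltW r_gt0) //.
  by rewrite mulr_ge0 ?exprn_ge0 // ltW.
by rewrite mulr_ge0 ?addr_ge0 // ltW.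
Qed.

End DataDefinedSpace.

(** * Norms of derivatives of diffusion polynomials and smoothness norms *)

Section SobolevNorms.
Context {R : realType} {X : ptopologicalType}.
Variables (rho : X -> X -> R) (G : set (set X)).
Variables (mu : probability (g_sigma_algebraType G) R).
Variables (lam : R^nat) (phi : nat -> X -> R) (q : R).
Hypothesis Xi : data_defined_space rho mu lam phi q.
Implicit Types (x y : X) (n K : R) (j k J : nat) (a M : nat -> R) (P f g : X -> R).

Local Notation T := (g_sigma_algebraType G).
Local Notation bm := (@bounded_meas _ T R).
Local Notation I f := (\int[mu]_x (f : T -> R) x).

Let mufin : (mu setT < +oo)%E := mu_fin mu.
Let bphi j : bm (phi j) := bounded_meas_phi Xi j.
Let orth := phi_orthonormal Xi.
#[local] Hint Resolve mufin bphi : core.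

(** One coefficient sequence represents [P] at every length from [J0] on, so that polynomials and
    kernels can be brought to a common length. *)
Lemma Pi_coef n P : Pi_ lam phi n P -> exists a J0,
  [/\ forall j, n <= lam j -> a j = 0, forall j, (J0 <= j)%N -> a j = 0 &
      forall J, (J0 <= J)%N -> P = fun x => \sum_(j < J) a j * phi j x].
Proof.
move=> [N [a ->]]; exists (fun j => if (j < N)%N && (lam j < n) then a j else 0), N; split.
- by move=> j nj; rewrite [lam j < n]ltNge nj andbF.
- by move=> j Nj; rewrite ltnNge Nj.
move=> J NJ; apply/funext => x.
rewrite big_mkcond (big_ord_widen J (fun j => if lam j < n then a j * phi j x else 0) NJ).
rewrite big_mkcond; apply: eq_bigr => j _ /=.
by case: (j < N)%N; case: (lam j < n) => /=; rewrite ?mul0r.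
Qed.

Lemma Pi_intro n a J : (forall j, n <= lam j -> a j = 0) ->
  Pi_ lam phi n (fun x => \sum_(j < J) a j * phi j x).
Proof.
move=> an; exists J, a; apply/funext => x; rewrite [RHS]big_mkcond /=.
by apply: eq_bigr => j _; case: ltP => // /an ->; rewrite mul0r.
Qed.

Lemma Pi0 n : Pi_ lam phi n (fun=> 0).
Proof. by exists 0%N, (fun=> 0); apply/funext => x; rewrite big_ord0. Qed.

Lemma le_Pi n n' P : n <= n' -> Pi_ lam phi n P -> Pi_ lam phi n' P.
Proof.
move=> nn' /Pi_coef[a [J [an _ aE]]]; rewrite (aE J) //; apply: Pi_intro => j nj.
by apply: an; exact: le_trans nj.
Qed.

Lemma Pi_lincomb n J a (P : nat -> X -> R) : (forall j, Pi_ lam phi n (P j)) ->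
  Pi_ lam phi n (fun x => \sum_(j < J) a j * P j x).
Proof.
move=> PP; elim: J => [|J IH].
  by rewrite (_ : (fun=> _) = fun=> 0); [exact: Pi0|apply/funext => x; rewrite big_ord0].
have [b [J1 [bn _ bE]]] := Pi_coef IH; have [c [J2 [cn _ cE]]] := Pi_coef (PP J).
have := @Pi_intro n (fun j => b j + a J * c j) (maxn J1 J2) => H.
rewrite (_ : (fun=> _) = fun x => \sum_(j < maxn J1 J2) (b j + a J * c j) * phi j x).
  by apply: H => j nj; rewrite bn // cn // mulr0 addr0.
apply/funext => x; rewrite big_ord_recr /=.
have /(congr1 (fun f => f x)) -> := bE _ (leq_maxl J1 J2).
have /(congr1 (fun f => f x)) -> := cE _ (leq_maxr J1 J2).
rewrite mulr_sumr -big_split /=; apply: eq_bigr => j _; ring.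
Qed.

Lemma bounded_meas_Pi n P : Pi_ lam phi n P -> bm P.
Proof.
by move=> /Pi_coef[a [J [_ _ aE]]]; rewrite (aE J) //; exact: (bounded_meas_comb bphi).
Qed.

Lemma mult_kernel_apply J M x f : bm f ->
  \int[mu]_y (mult_kernel phi J M x y * f y) =
  \sum_(j < J) M j * phi j x * \int[mu]_y (f y * phi j y).
Proof.
move=> bf; rewrite /mult_kernel.
have E y : (\sum_(j < J) M j * phi j x * phi j y) * f y =
   \sum_(j < J) M j * phi j x * (f y * phi j y).
  by rewrite mulr_suml; apply: eq_bigr => j _; ring.
under eq_fun do rewrite E.
rewrite bounded_meas_Rintegral_sum //; last first.
  by move=> j; apply: bounded_measZ; exact: bounded_measM.
by apply: eq_bigr => j _; rewrite bounded_meas_RintegralZ //; exact: bounded_measM.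
Qed.

Lemma mult_kernel_bound J M f (L B : R) x : bm f -> 0 <= B ->
  I (fun y => `|mult_kernel phi J M x y|) <= L -> (forall y, `|f y| <= B) ->
  `|\int[mu]_y (mult_kernel phi J M x y * f y)| <= L * B.
Proof.
move=> bf B0 kL fB.
have bk : bm (mult_kernel phi J M x) := bounded_meas_mult_kernel bphi J M x.
apply: le_trans (bounded_meas_Rintegral_norm mufin (bounded_measM bk bf)) _.
have pt y : `|mult_kernel phi J M x y * f y| <= B * `|mult_kernel phi J M x y|.
  by rewrite normrM mulrC ler_wpM2r.
apply: le_trans (bounded_meas_le mufin _ _ pt) _.
- by apply: bounded_meas_norm; exact: bounded_measM.
- by apply: bounded_measZ; exact: bounded_meas_norm.
rewrite bounded_meas_RintegralZ //; last exact: bounded_meas_norm.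
by rewrite mulrC; exact: ler_wpM2r.
Qed.

Variables (h : R -> R) (r : R).
Hypothesis hh : filter_function h.
Hypothesis r_gt0 : 0 < r.

Lemma bernstein_inequality : exists2 C : R, 0 <= C & forall n P, 1 <= n ->
  Pi_ lam phi n P -> exists D, [/\ Pi_ lam phi n D,
    forall k, fourier_coef mu phi D k = (lam k + 1) `^ r * fourier_coef mu phi P k,
    forall B, 0 <= B -> (forall x, `|P x| <= B) -> forall x, `|D x| <= C * n `^ r * B &
    I (fun x => `|D x|) <= C * n `^ r * I (fun x => `|P x|)].
Proof.
have [C C0 hC] := bernstein_kernel Xi hh r_gt0.
exists C => // n P n1 PP; have [M [J1 [hM hk]]] := hC _ n1.
have [a [J0 [an aJ aE]]] := Pi_coef PP; set J := maxn J0 J1.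
have PE : P = fun x => \sum_(j < J) a j * phi j x by apply: aE; exact: leq_maxl.
have kJ x : I (fun y => `|mult_kernel phi J M x y|) <= C * n `^ r.
  by apply: hk; exact: leq_maxr.
(* The values of [M] at frequencies [n] and above do not matter, since [a] vanishes there. *)
have Ma j : M j * a j = (lam j + 1) `^ r * a j.
  by have [/an->|/hM->//] := leP n (lam j); rewrite !mulr0.
pose D x := \sum_(j < J) ((lam j + 1) `^ r * a j) * phi j x.
have DP : Pi_ lam phi n D.
  by apply: (@Pi_intro n (fun j => (lam j + 1) `^ r * a j) J) => j /an ->; rewrite mulr0.
have bP : bm P by exact: bounded_meas_Pi PP.
have bD : bm D by exact: bounded_meas_Pi DP.
have L0 : 0 <= C * n `^ r by rewrite mulr_ge0 // powR_ge0.
exists D; split => //.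
- move=> k; rewrite /fourier_coef PE !(Rintegral_comb_phi mufin bphi orth) //.
  rewrite (Rintegral_comb_phi mufin bphi orth J (fun j => (lam j + 1) `^ r * a j)).
  by case: ifP => _ //; rewrite mulr0.
- move=> B B0 PB x.
  rewrite (_ : D x = \int[mu]_y (mult_kernel phi J M x y * P y)).
    exact: mult_kernel_bound.
  rewrite mult_kernel_apply //; apply: eq_bigr => j _.
  rewrite PE (Rintegral_comb_phi mufin bphi orth) ltn_ord.
  by rewrite -Ma; ring.
(* duality: pair [D] with its sign and move the multiplier to the other side *)
pose E := [set y : T | 0 <= D y].
have mE : measurable E.
  rewrite /E (_ : [set y | _] = setT `&` (D : T -> R) @^-1` `[0, +oo[).
    by case: bD => mD _; exact: mD.
  by apply/seteqP; split => y /=; rewrite in_itv /= andbT // => -[].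
pose s y : R := 2 * (\1_E : T -> R) y - 1.
have bs : bm s.
  have bI := bounded_meas_indic (R := R) mE.
  exact: bounded_measB (bounded_measZ 2 bI) (bounded_meas_cst 1).
have sE y : s y = if 0 <= D y then 1 else -1.
  rewrite /s indicE; case: ifPn => Dy; first by rewrite mem_set //= mulr1; lra.
  by rewrite memNset /=; [rewrite mulr0 sub0r|exact/negP].
have s1 y : `|s y| <= 1 by rewrite sE; case: ifP; rewrite ?normrN normr1.
have Ds y : `|D y| = D y * s y.
  rewrite sE; case: ifPn => [/ger0_norm->|]; first by rewrite mulr1.
  by rewrite -ltNge => /ltr0_norm ->; ring.
pose Gs z := \int[mu]_y (mult_kernel phi J M z y * s y).
have GsE : Gs = fun z => \sum_(j < J) (M j * \int[mu]_y (s y * phi j y)) * phi j z.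
  by apply/funext => z; rewrite /Gs mult_kernel_apply //; apply: eq_bigr => j _; rewrite mulrAC.
have bG : bm Gs.
  by rewrite GsE; exact: (bounded_meas_comb bphi J (fun j => M j * \int[mu]_y (s y * phi j y))).
have -> : I (fun x => `|D x|) = \int[mu]_x (P x * Gs x).
  under eq_fun do rewrite Ds.
  have E1 x : D x * s x = \sum_(j < J) ((lam j + 1) `^ r * a j) * (s x * phi j x).
    by rewrite /D mulr_suml; apply: eq_bigr => j _; rewrite -mulrA [phi j x * _]mulrC.
  have E2 x : P x * Gs x = \sum_(j < J) (M j * \int[mu]_y (s y * phi j y)) * (P x * phi j x).
    by rewrite GsE mulr_sumr; apply: eq_bigr => j _; rewrite mulrCA.
  rewrite (funext E1) (funext E2).
  rewrite !bounded_meas_Rintegral_sum //; last 2 first.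
  - by move=> j; apply: bounded_measZ; exact: bounded_measM.
  - by move=> j; apply: bounded_measZ; exact: bounded_measM.
  apply: eq_bigr => j _; rewrite !bounded_meas_RintegralZ //; last 2 first.
  - exact: bounded_measM.
  - exact: bounded_measM.
  by rewrite [in RHS]PE (Rintegral_comb_phi mufin bphi orth) ltn_ord -Ma; ring.
apply: le_trans (ler_norm _) _.
apply: le_trans (bounded_meas_Rintegral_norm mufin (bounded_measM bP bG)) _.
have pt y : `|P y * Gs y| <= C * n `^ r * `|P y|.
  rewrite normrM mulrC; apply: ler_wpM2r => //.
  by rewrite -[leRHS]mulr1; exact: mult_kernel_bound.
apply: le_trans (bounded_meas_le mufin _ _ pt) _.
- by apply: bounded_meas_norm; exact: bounded_measM.
- by apply: bounded_measZ; exact: bounded_meas_norm.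
by rewrite bounded_meas_RintegralZ //; exact: bounded_meas_norm.
Qed.

(** Interpolation between L^1 and the sup norm: [|g|^v] is at most [|g|] times the sup bound to the
    power [v - 1]. For [p = +oo] the exponent is [q], because the inverse of [+oo] is 0. *)
Lemma Lp_norm_le (p : \bar R) g n K : (1 <= p)%E -> 1 <= n -> 0 <= K -> bm g ->
  (forall x, `|g x| <= K * n `^ q) -> I (fun x => `|g x|) <= K ->
  (Lp_norm mu p g <= (K * n `^ (q - fine (q%:E / p)%E))%:E)%E.
Proof.
move=> p1 n1 K0 bg gK IgK; rewrite /Lp_norm unlock.
have n0 : 0 < n by exact: lt_le_trans n1.
case: p p1 => [v|_|//]; last first.
  have m0 : (0 < mu setT)%E by rewrite (mu_setT mu) lte01.
  have -> : fine (q%:E / +oo)%E = 0 :> R by rewrite invey mule0.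
  rewrite (ifT _ _ m0) subr0; apply/ess_supP; apply: nearW => x /=.
  by rewrite lee_fin; exact: gK.
rewrite lee_fin => v1; have v0 : 0 < v by exact: lt_le_trans v1.
have -> : fine (q%:E / v%:E)%E = q / v by rewrite inver gt_eqF.
have bgv : bm (fun x => `|g x| `^ v).
  split.
    have := bounded_meas_norm bg; case=> mg _.
    exact: (measurableT_comp (measurable_powR v) mg).
  exists ((K * n `^ q) `^ v) => x; rewrite ger0_norm ?powR_ge0 //.
  by apply: ge0_ler_powR; rewrite ?nnegrE ?(ltW v0) // (le_trans _ (gK x)).
have Kn0 : 0 <= K * n `^ q by rewrite mulr_ge0 // powR_ge0.
have pt x : `|g x| `^ v <= (K * n `^ q) `^ (v - 1) * `|g x|.
  have [->|gx] := eqVneq `|g x| 0; first by rewrite powR0 ?gt_eqF // mulr0.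
  rewrite -mulr_powRB1 // mulrC; apply: ler_wpM2r => //.
  by apply: ge0_ler_powR; rewrite ?nnegrE ?subr_ge0.
have Iv : I (fun x => `|g x| `^ v) <= (K * n `^ (q - q / v)) `^ v.
  apply: le_trans (bounded_meas_le mufin bgv _ pt) _.
    by apply: bounded_measZ; exact: bounded_meas_norm.
  rewrite bounded_meas_RintegralZ //; last exact: bounded_meas_norm.
  apply: le_trans (ler_wpM2l _ IgK) _; first exact: powR_ge0.
  rewrite !powRM ?powR_ge0 // -!powRrM mulrAC -[_ * K]mulrC mulr_powRB1 //.
  apply: ler_wpM2l; first exact: powR_ge0.
  rewrite le_eqVlt; apply/orP; left; apply/eqP; congr (_ `^ _).
  by field; rewrite gt_eqF.
rewrite (_ : (\int[mu]_x _)%E = (I (fun x => `|g x| `^ v))%:E); last first.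
  by rewrite -RintegralE.
rewrite poweR_EFin lee_fin.
have -> : K * n `^ (q - q / v) = ((K * n `^ (q - q / v)) `^ v) `^ v^-1.
  by rewrite -powRrM divff ?gt_eqF // powRr1 // mulr_ge0 // powR_ge0.
apply: ge0_ler_powR; rewrite ?nnegrE ?invr_ge0 ?(ltW v0) ?powR_ge0 //.
by apply: Rintegral_ge0 => x _; exact: powR_ge0.
Qed.

Lemma bounded_meas_Lfun (p : \bar R) g : (1 <= p)%E -> bm g -> (g : T -> R) \in Lfun mu p.
Proof.
move=> p1 bg; have [mg [M gM]] := bg.
have M0 : 0 <= M by apply: le_trans (gM point).
apply/andP; split; rewrite inE //=.
apply: le_lt_trans (@Lp_norm_le p g 1 M p1 _ M0 bg _ _) (ltry _) => //.
  by move=> x; rewrite powR1 mulr1.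
apply: le_trans (bounded_meas_le mufin (bounded_meas_norm bg) (bounded_meas_cst M) gM) _.
by rewrite Rintegral_cst // [fine _](congr1 fine (mu_setT mu)) mulr1.
Qed.

Lemma Pi_Xp (p : \bar R) n P : (1 <= p)%E -> 0 < n -> Pi_ lam phi n P ->
  Xp mu lam phi p P.
Proof.
move=> p1 n0 PP; split.
  by apply: bounded_meas_Lfun => //; exact: bounded_meas_Pi PP.
move=> e e0; exists P; first by exists n.
rewrite /Lp_norm (_ : EFin \o _ = cst 0%E); last by apply/funext => x /=; rewrite subrr.
by rewrite Lnorm0 ?lte_fin // gt_eqF // (lt_le_trans _ p1).
Qed.

Lemma H_norm_le (gamma : R) (p : \bar R) : 0 < gamma -> gamma < r -> (1 <= p)%E ->
  exists2 C, 0 < C & forall n P K, 1 <= n -> 0 <= K -> Pi_ lam phi n P ->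
    (forall x, `|P x| <= K * n `^ q) -> I (fun x => `|P x|) <= K ->
    (H_norm mu lam phi r gamma p P <=
       (C * n `^ gamma * (K * n `^ (q - fine (q%:E / p)%E)))%:E)%E.
Proof.
move=> g0 gr p1; have [C C0 hC] := bernstein_inequality.
exists (2 + C); first by lra.
move=> n P K n1 K0 PP PB IP; have n0 : 0 < n by exact: lt_le_trans n1.
have [D [DP Dcoef Dsup DI]] := hC _ _ n1 PP.
set L := K * n `^ _.
have L0 : 0 <= L by rewrite mulr_ge0 // powR_ge0.
have Cn : 0 <= C * n `^ r by rewrite mulr_ge0 // powR_ge0.
have LP : (Lp_norm mu p P <= L%:E)%E.
  by apply: Lp_norm_le => //; exact: bounded_meas_Pi PP.
have LD : (Lp_norm mu p D <= (C * n `^ r * L)%:E)%E.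
  rewrite /L mulrA; apply: Lp_norm_le => //.
  - by rewrite mulr_ge0.
  - exact: bounded_meas_Pi DP.
  - move=> x; rewrite -mulrA; apply: Dsup => //.
    by rewrite mulr_ge0 // powR_ge0.
  - by apply: le_trans DI _; exact: ler_wpM2l.
have Lp0 f : (forall x, f x = 0) -> Lp_norm mu p f = 0%E.
  move=> f0; rewrite /Lp_norm (_ : EFin \o _ = cst 0%E); last by apply/funext => x /=; rewrite f0.
  by rewrite Lnorm0 // gt_eqF // (lt_le_trans _ p1).
have f0 k : fourier_coef mu phi (fun=> 0) k = 0.
  rewrite /fourier_coef (_ : (fun=> _) = fun=> 0); last by apply/funext => x; rewrite mul0r.
  by rewrite Rintegral_cst // mul0r.
have D0 : is_Delta mu lam phi p r (fun=> 0) (fun=> 0).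
  by split=> [||k]; [exact: Pi_Xp (Pi0 n)|exact: Pi_Xp (Pi0 n)|rewrite !f0 mulr0].
have D1 : is_Delta mu lam phi p r P D.
  by split; [exact: Pi_Xp PP|exact: Pi_Xp DP|exact: Dcoef].
have ng1 : 1 <= n `^ gamma.
  by rewrite -(powRr0 n) ler_powR // ltW.
apply: (@le_trans _ _ (L%:E + ((1 + C) * n `^ gamma * L)%:E)%E); last first.
  rewrite -EFinD lee_fin -subr_ge0.
  rewrite (_ : _ - _ = (n `^ gamma - 1) * L); last by ring.
  by rewrite mulr_ge0 // subr_ge0.
apply: leeD => //; apply: ge_ereal_sup => _ [delta /andP[d0 d1] <-].
have dg0 : (0 <= (delta `^ (- gamma))%:E)%E by rewrite lee_fin powR_ge0.
have nr : n `^ r = n `^ gamma * n `^ (r - gamma).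
  by rewrite -powRD ?(gt_eqF n0) ?implybT //; congr (_ `^ _); ring.
have [dn|dn] := leP n^-1 delta.
  have om : (omega mu lam phi r p P delta <= L%:E)%E.
    apply: ge_ereal_inf; eexists; first by exists (fun=> 0), (fun=> 0); split; [exact: D0|].
    rewrite (Lp0 (fun=> 0)) // mule0 adde0.
    by rewrite (_ : P \- (fun=> 0) = P) //; apply/funext => x /=; rewrite subr0.
  apply: le_trans (lee_wpmul2l dg0 om) _; rewrite -EFinM lee_fin.
  apply: ler_wpM2r => //; apply: (@le_trans _ _ (n `^ gamma)).
    rewrite powRN -div1r ler_pdivrMr ?powR_gt0 // -powRM ?(ltW n0) ?(ltW d0) //.
    rewrite [leLHS](_ : 1 = 1 `^ gamma); last by rewrite powR1.
    apply: ge0_ler_powR; rewrite ?nnegrE ?mulr_ge0 ?(ltW n0) ?(ltW d0) ?(ltW g0) //.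
    by rewrite mulrC -ler_pdivrMr // div1r.
  by rewrite ler_peMl ?powR_ge0 // lerDl.
have om : (omega mu lam phi r p P delta <= (delta `^ r * (C * n `^ r * L))%:E)%E.
  apply: ge_ereal_inf; eexists; first by exists P, D; split; [exact: D1|].
  rewrite (Lp0 (P \- P)%R) ?add0e; last by move=> x /=; rewrite subrr.
  by rewrite EFinM; apply: lee_wpmul2l; rewrite ?lee_fin ?powR_ge0.
apply: le_trans (lee_wpmul2l dg0 om) _; rewrite -EFinM lee_fin.
have -> : delta `^ (- gamma) * (delta `^ r * (C * n `^ r * L)) =
   (delta * n) `^ (r - gamma) * (C * n `^ gamma * L).
  rewrite powRM ?(ltW d0) ?(ltW n0) // nr.
  rewrite (_ : delta `^ (r - gamma) = delta `^ (- gamma) * delta `^ r); first by ring.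
  by rewrite -powRD ?(gt_eqF d0) ?implybT //; congr (_ `^ _); ring.
apply: (@le_trans _ _ (C * n `^ gamma * L)); last first.
  rewrite -!mulrA; apply: ler_wpM2r; last by rewrite lerDr.
  by rewrite mulr_ge0 // powR_ge0.
apply: ler_piMl; first by rewrite !mulr_ge0 // powR_ge0.
have rg : 0 <= r - gamma by rewrite subr_ge0 ltW.
rewrite [leRHS](_ : 1 = 1 `^ (r - gamma)); last by rewrite powR1.
apply: ge0_ler_powR; rewrite ?nnegrE ?mulr_ge0 ?(ltW d0) ?(ltW n0) //.
by rewrite -ler_pdivlMr // div1r ltW.
Qed.

End SobolevNorms.

(** * Full support of the reference measure *)

Section FullSupport.
Context {R : realType} {X : ptopologicalType}.
Variables (rho : X -> X -> R) (G : set (set X)).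
Variables (mu : probability (g_sigma_algebraType G) R).
Variables (lam : R^nat) (phi : nat -> X -> R) (q : R).
Hypothesis Xi : data_defined_space rho mu lam phi q.
Implicit Types (x y : X) (n N : R) (f : X -> R).

Local Notation T := (g_sigma_algebraType G).
Local Notation bm := (@bounded_meas _ T R).
Local Notation I f := (\int[mu]_x (f : T -> R) x).

Let mufin : (mu setT < +oo)%E := mu_fin mu.
Let bphi j : bm (phi j) := bounded_meas_phi Xi j.
Let orth := phi_orthonormal Xi.
#[local] Hint Resolve mufin bphi : core.

(* The heat kernel integrates to 1 but is negligible away from its pole, so no
   ball is [mu]-null. *)
Lemma oball_gt0 x (delta : R) : 0 < delta -> (0 < mu (oball rho x delta))%E.
Proof.
move=> d0; rewrite ltNge; apply/negP => mu0.
have mB : measurable (oball rho x delta : set T).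
  by apply: (open_borel Xi); exact: (open_oball Xi).
have {}mu0 : mu (oball rho x delta) = 0%E.
  by apply/eqP; rewrite eq_le mu0 measure_ge0.
have [k3 [k4 [k30 k40 hb]]] := dds_heat_bound Xi.
have q0 := dds_q_gt0 Xi.
pose b := (Num.truncn q).+1.
have qb : q <= b%:R by apply: ltW; exact: truncnS_gt.
have b0 : (0 : R) < b%:R by rewrite ltr0n.
set s := k4 * delta ^+ 2; have s0 : 0 < s by rewrite mulr_gt0 // exprn_gt0.
pose A := k3 * (b%:R / s) ^+ b.
have A0 : 0 <= A by rewrite mulr_ge0 ?exprn_ge0 ?divr_ge0 // ltW.
(* Outside the ball the kernel is at most [A * N ^- b]; since [b >= 1], this [N] makes it at most
   [4^-1]. *)
pose N := 4 * A + 1.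
have N1 : 1 <= N by rewrite /N; lra.
have N0 : 0 < N by lra.
have t01 : 0 < 1%:R / N ^+ 2 <= 1.
  by apply: (@heat_time R N 0) => //; exact: exprn_ege1.
set t := 1%:R / N ^+ 2 in t01.
have off y : ~ oball rho x delta y -> `|heat_kernel lam phi t x y| <= 4^-1.
  move=> yd; have {}yd : delta <= rho x y by rewrite leNgt; exact/negP.
  apply: le_trans (hb t x y t01) _.
  apply: (@le_trans _ _ (k3 * N `^ q * expR (- (s * N ^+ 2)))).
    apply: ler_pM; rewrite ?mulr_ge0 ?powR_ge0 ?expR_ge0 ?(ltW k30) //.
      by rewrite ler_pM2l //; exact: (@heat_time_powR R q q0 N 0).
    rewrite ler_expR lerN2 /t div1r invrK ler_pM2r ?exprn_gt0 // ler_pM2l //.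
    by rewrite ler_sqr ?nnegrE ?(ltW d0) // (le_trans (ltW d0)).
  set z := s * N ^+ 2 / b%:R.
  have z0 : 0 <= z by rewrite divr_ge0 ?mulr_ge0 ?sqr_ge0 // ltW.
  have eb : z ^+ b <= expR (s * N ^+ 2).
    have -> : s * N ^+ 2 = b%:R * z by rewrite /z; field; rewrite gt_eqF.
    rewrite expRM_natl; apply: lerXn2r; rewrite ?nnegrE ?expR_ge0 //.
    by apply: le_trans (expR_ge1Dx _); rewrite lerDr.
  rewrite expRN ler_pdivrMr ?expR_gt0 //.
  have h4 : 4^-1 * z ^+ b <= 4^-1 * expR (s * N ^+ 2) by rewrite ler_wpM2l.
  apply: le_trans h4; apply: (@le_trans _ _ (k3 * N ^+ b)).
    by rewrite ler_pM2l // -powR_mulrn ?ler_powR // ltW.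
  have E : k3 * N ^+ b * N ^+ b = A * z ^+ b.
    rewrite /A -[RHS]mulrA -exprMn -mulrA -exprMn; congr (_ * _ ^+ _).
    by rewrite /z; field; rewrite !gt_eqF.
  have Nb0 : 0 < N ^+ b by rewrite exprn_gt0.
  rewrite -(ler_pM2r Nb0) E -subr_ge0.
  rewrite (_ : _ - _ = z ^+ b * (4^-1 * N ^+ b - A)); last by ring.
  rewrite mulr_ge0 ?exprn_ge0 //.
  have : N <= N ^+ b by rewrite /b exprS ler_peMr ?exprn_ege1 // ltW.
  rewrite {1}/N; lra.
pose K := heat_kernel lam phi t x.
have bK : bm K := bounded_meas_heat (T := T) bphi k30 k40 (dds_heat_cvg Xi) hb x t01.
have [_ [M KM]] := bK.
have M0 : 0 <= M by apply: le_trans (KM x).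
have IK : I (fun y => `|K y|) <= 4^-1.
  have bI := bounded_meas_indic (R := R) mB.
  have pt y : `|K y| <= M * (\1_(oball rho x delta : set T) : T -> R) y + 4^-1.
    rewrite indicE; have [/set_mem yB|] := boolP (y \in (oball rho x delta : set T)).
      by rewrite mulr1; apply: le_trans (KM y) _; rewrite lerDl.
    by rewrite notin_setE mulr0 add0r => /off.
  apply: le_trans (bounded_meas_le mufin (bounded_meas_norm bK)
    (bounded_measD (bounded_measZ M bI) (bounded_meas_cst 4^-1)) pt) _.
  rewrite bounded_meas_RintegralD //; last 2 first.
  - exact: bounded_measZ.
  - exact: bounded_meas_cst.
  rewrite bounded_meas_RintegralZ // Rintegral_indic_fine //.
  rewrite [fine _](congr1 fine mu0) mulr0 add0r Rintegral_cst //.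
  by rewrite [fine _](congr1 fine (mu_setT mu)) mulr1.
set L := k3 * N `^ q.
have L0 : 0 < L by rewrite mulr_gt0 // powR_gt0.
(* Beyond this index the heat weights are at most [(8 * L)^-1], which makes the squared L^2 norm of
   the tail at most [8^-1]. The integral is evaluated on the partial sum [S], where orthogonality to
   [phi 0 = 1] gives exactly 1. *)
have [n hn] := lam_eventually_ge Xi (N * (8 * L + 1)).
pose c j := expR (- (lam j / N) ^+ 2) * phi j x.
pose S y := \sum_(j < n.+1) c j * phi j y.
have bS : bm S := bounded_meas_comb bphi n.+1 c.
have IS : I S = 1.
  have := Rintegral_comb_phi mufin bphi orth n.+1 c 0; rewrite /= /c.
  rewrite (dds_lam0 Xi) (dds_phi0 Xi) mul0r expr0n oppr0 expR0 mulr1 => <-.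
  by apply: eq_Rintegral => y _; rewrite (dds_phi0 Xi) mulr1.
have KS : I (fun y => (K y - S y) ^+ 2) <= 8^-1.
  apply: (Rintegral_sqr_series_le mufin bphi orth (b := fun j => if (j < n.+1)%N then 0 else c j)).
  - exact: bounded_measB.
  - move=> y; pose U J := heat_series lam phi t x y J - S y.
    have cU : U J @[J --> \oo] --> K y - S y.
      by apply: cvgB; [exact: dds_heat_cvg Xi _ _ _ t01|exact: cvg_cst].
    apply: cvg_trans cU; apply: near_eq_cvg; exists n.+1 => // J /= nJ.
    rewrite /U /t (heat_seriesE (T := T) lam phi 0) ?gt_eqF // /S.
    rewrite (big_ord_widen J (fun j => c j * phi j y) nJ) [X in _ - X]big_mkcond -sumrB.
    apply: eq_bigr => j _; rewrite /c expr0 mulr1; case: ifP => _.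
      by rewrite subrr mul0r.
    by rewrite subr0.
  move=> J; apply: (@le_trans _ _ (\sum_(j < J) (8 * L)^-1 *
      (expR (- (lam j / N) ^+ 2) * phi j x ^+ 2))).
    apply: ler_sum => j _; case: ifPn => [_|].
      rewrite expr0n /=; apply: mulr_ge0; first by rewrite invr_ge0 mulr_ge0 // ltW.
      by rewrite mulr_ge0 ?expR_ge0 ?sqr_ge0.
    rewrite -leqNgt => /ltnW/hn lj; rewrite /c exprMn expr2 -!mulrA.
    apply: ler_wpM2r; first by rewrite mulr_ge0 ?expR_ge0 ?sqr_ge0.
    have lz : 8 * L + 1 <= lam j / N by rewrite ler_pdivlMr // mulrC.
    have L8 : 0 < 8 * L by rewrite mulr_gt0.
    rewrite expRN lef_pV2 ?posrE ?expR_gt0 //.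
    apply: le_trans (expR_ge1Dx _).
    have : (8 * L + 1) ^+ 2 <= (lam j / N) ^+ 2 by rewrite ler_sqr ?nnegrE //; lra.
    nra.
  rewrite -mulr_sumr.
  have := christoffel_bound (T := T) (rhoxx Xi) q0 k30 (dds_heat_cvg Xi) hb x J N1.
  move=> h; apply: le_trans (ler_wpM2l _ h) _; first by rewrite invr_ge0 mulr_ge0 // ltW.
  by rewrite -/L invfM -mulrA mulVf ?mulr1 // gt_eqF.
(* Integrating gives [1 <= 4^-1 + 2 * 8^-1 + 8^-1], a contradiction. *)
have pt y : S y <= `|K y| + (2 * (K y - S y) ^+ 2 + 8^-1).
  have h1 := ler_norm (K y); have h2 := sqr_ge0 (4 * (K y - S y) + 1); nra.
have bKS : bm (fun y => (K y - S y) ^+ 2) by apply: bounded_measX; exact: bounded_measB.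
have bKn := bounded_meas_norm bK.
have b8 : bm (fun=> 8^-1) := bounded_meas_cst 8^-1.
have b2 : bm (fun y => 2 * (K y - S y) ^+ 2 + 8^-1).
  by apply: bounded_measD => //; exact: bounded_measZ.
have := bounded_meas_le mufin bS (bounded_measD bKn b2) pt.
rewrite bounded_meas_RintegralD // bounded_meas_RintegralD //; last exact: bounded_measZ.
rewrite bounded_meas_RintegralZ // Rintegral_cst // IS.
rewrite [fine _](congr1 fine (mu_setT mu)) mulr1.
lra.
Qed.

(** The set where the bound fails is open, so if nonempty it contains a ball, which has positive
    measure. *)
Lemma continuous_ess_bound f (B : R) : continuous f ->
  (Lp_norm mu +oo f <= B%:E)%E -> forall x, `|f x| <= B.
Proof.
move=> cf; rewrite /Lp_norm unlock.
have m0 : (0 < mu setT)%E by rewrite (mu_setT mu) lte01.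
rewrite (ifT _ _ m0) => /ess_supP[Z [mZ Z0 fZ]] x; rewrite leNgt; apply/negP => fx.
have [Bo Bx] := dds_basis Xi.
have U : nbhs x [set y | B < `|f y|].
  apply: (open_nbhs_nbhs); split => //.
  apply: (@open_comp _ _ (fun y => `|f y|) [set z | B < z]); last exact: open_gt.
  by move=> y _; apply: continuous_comp; [exact: cf|exact: norm_continuous].
have [V [[x' [d [d0 ->]]] _] VU] := Bx x _ U.
have := oball_gt0 x' d0; rewrite ltNge => /negP; apply.
rewrite -Z0; apply: le_measure; rewrite ?inE //.
  by apply: (open_borel Xi); exact: (open_oball Xi).
move=> y /VU /= fy; apply: fZ => /=; rewrite lee_fin.
by apply/negP; rewrite -ltNge.
Qed.

End FullSupport.

(** * Masses of balls *)

Lemma sum_pair_mean {R : realType} J (f : nat -> R) :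
  \sum_(j < J) \sum_(k < J) ((f j + f k) / 2) = J%:R * \sum_(j < J) f j.
Proof.
have e1 : \sum_(j < J) \sum_(k < J) f k = J%:R * \sum_(j < J) f j.
  by rewrite sumr_const card_ord mulr_natl.
have e2 : \sum_(j < J) \sum_(k < J) f j = J%:R * \sum_(j < J) f j.
  by rewrite exchange_big.
transitivity ((\sum_(j < J) \sum_(k < J) f j + \sum_(j < J) \sum_(k < J) f k) / 2).
  rewrite mulrDl !mulr_suml -big_split; apply: eq_bigr => j _ /=.
  by rewrite !mulr_suml -big_split; apply: eq_bigr => k _; rewrite mulrDl.
by rewrite e1 e2; field.
Qed.

Section RegularMeasures.
Context {R : realType} {X : ptopologicalType}.
Variables (rho : X -> X -> R) (G : set (set X)).
Variables (mu : probability (g_sigma_algebraType G) R).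
Variables (lam : R^nat) (phi : nat -> X -> R) (q : R).
Hypothesis Xi : data_defined_space rho mu lam phi q.
Implicit Types (x y : X) (n N m : R) (j k J : nat) (P f : X -> R).

Local Notation T := (g_sigma_algebraType G).
Local Notation bm := (@bounded_meas _ T R).
Local Notation I f := (\int[mu]_x (f : T -> R) x).

Let mufin : (mu setT < +oo)%E := mu_fin mu.
Let bphi j : bm (phi j) := bounded_meas_phi Xi j.
Let orth := phi_orthonormal Xi.
#[local] Hint Resolve mufin bphi : core.

Lemma tvar_le (G' : set (set X)) (nu : {measure set (g_sigma_algebraType G') -> \bar R})
  (E : set X) : (tvar nu E <= nu E)%E.
Proof.
apply: ge_ereal_sup => _ [F [mF tF <-] <-].
rewrite measure_bigcup //.
rewrite le_eqVlt; apply/orP; left; apply/eqP.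
apply/congr_lim/funext => n; apply: eq_big => [i|i _]; first by rewrite in_setT.
by rewrite gee0_abs.
Qed.

Lemma Pi_continuous n P : Pi_ lam phi n P -> continuous P.
Proof.
move=> /Pi_coef[a [J [_ _ aE]]]; rewrite (aE J) //.
elim: J {aE} => [|J IH] x.
  by rewrite (_ : (fun=> _) = cst 0); [exact: cvg_cst|apply/funext => y; rewrite big_ord0].
rewrite (_ : (fun=> _) = (fun y => \sum_(j < J) a j * phi j y) \+ (fun y => a J * phi J y)).
  apply: continuousD; first exact: IH.
  by apply: continuousM; [exact: cvg_cst|exact: dds_phi_continuous Xi J x].
by apply/funext => y; rewrite big_ord_recr.
Qed.

Lemma product_approx (S : R) : 0 < S -> product_assumption mu lam phi ->
  exists B N0 : R, [/\ 2 <= B, 1 <= N0 & forall N j k, N0 <= N -> lam j <= N -> lam k <= N ->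
    exists2 P, Pi_ lam phi (B * N) P &
      forall y, `|phi j y * phi k y - P y| <= 2 * N `^ (- S)].
Proof.
move=> S0 [B B2 /(_ _ S0) cv].
have nb : nbhs (0 : \bar R)%E [set z | z < 1]%E.
  by apply: open_nbhs_nbhs; split; [exact: open_ereal_lt_ereal|exact: lte01].
have [N0 [_ hN0]] := cv _ nb.
exists B, (Num.max 1 (N0 + 1)); split => //; first by rewrite le_max lexx.
move=> N j k; rewrite ge_max => /andP[N1 N0N] jN kN.
have NN : N0 < N by apply: lt_le_trans N0N; rewrite ltrDl.
have N_gt0 : 0 < N by exact: lt_le_trans N1.
have := hN0 N NN; rewrite /= => eps1.
set inf := ereal_inf [set Lp_norm mu +oo%E (fun x => phi j x * phi k x - P x)
                  | P in Pi_ lam phi (B * N)].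
have : (inf < (2 * N `^ (- S))%:E)%E.
  rewrite ltNge; apply/negP => h; move: eps1; rewrite ltNge => /negP; apply.
  have h1 : ((2 * N `^ (- S))%:E <= product_eps mu lam phi B N)%E.
    by apply: le_trans h _; apply: ereal_sup_ubound; exists j, k.
  apply: (@le_trans _ _ ((N `^ S)%:E * (2 * N `^ (- S))%:E)%E).
    by rewrite -EFinM lee_fin mulrCA powRN divff ?gt_eqF ?powR_gt0 // mulr1 ler1n.
  by apply: lee_wpmul2l => //; rewrite lee_fin powR_ge0.
move=> /ereal_inf_lt[_ [P PP <-] hP]; exists P => //.
apply: (continuous_ess_bound Xi); last exact: ltW.
move=> y; apply: cvgB; last exact: Pi_continuous PP y.
by apply: cvgM; exact: dds_phi_continuous Xi _ y.
Qed.

Variables (h : R -> R) (beta c0 : R) (p : \bar R) (gamma r A : R).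
Hypothesis prodA : product_assumption mu lam phi.
Hypothesis hh : filter_function h.
Hypothesis beta_gt0 : 0 < beta.
Hypothesis c0_gt0 : 0 < c0.
Hypothesis Phi_lb : forall x m, 1 <= m -> forall y, cball rho x (beta / m) y ->
  c0 * m `^ q <= `|Phi_kernel lam phi h m x y|.
Hypothesis p_ge1 : (1 <= p)%E.
Hypothesis gamma_gt0 : 0 < gamma.
Hypothesis r_gt : gamma < r.
Hypothesis A_gt0 : 0 < A.

Let r_gt0 : 0 < r. Proof. exact: lt_trans r_gt. Qed.

Definition quadrature n (Gnu : set (set X))
    (nu : {measure set (g_sigma_algebraType Gnu) -> \bar R}) :=
  forall P, Pi_ lam phi n P ->
    (`| \int[mu]_x (P x)%:E - \int[nu]_x (P x)%:E |
       <= A%:E * H_norm mu lam phi r gamma p P * (n `^ (- gamma))%:E)%E.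

Let tau := fine (q%:E / p)%E.

Lemma tau_itv : 0 <= tau <= q.
Proof.
have q0 := dds_q_gt0 Xi; rewrite /tau; case: p p_ge1 => [v|_|//].
  rewrite lee_fin => v1; have v0 : 0 < v by exact: lt_le_trans v1.
  rewrite inver gt_eqF //= divr_ge0 ?(ltW q0) ?(ltW v0) //=.
  by rewrite ler_pdivrMr // ler_peMr // ltW.
by rewrite invey mule0 lexx ltW.
Qed.

(** The test function 1 lies in [Pi_ 1], so its norm is estimated at [n = 1], independently of the
    actual [n]. *)
Lemma total_mass : exists2 C, 0 < C & forall n Gnu
  (nu : {measure set (g_sigma_algebraType Gnu) -> \bar R}),
  1 <= n -> quadrature n nu -> (nu setT <= C%:E)%E.
Proof.
have [C C0 hC] := H_norm_le Xi hh r_gt0 gamma_gt0 r_gt p_ge1.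
exists (1 + A * C); first by rewrite addr_gt0 // mulr_gt0.
move=> n Gnu nu n1 /(_ (fun=> 1)) H.
have P1 : Pi_ lam phi 1 (fun=> 1).
  exists 1%N, (fun=> 1); apply/funext => x; rewrite big_mkcond big_ord1 /=.
  by rewrite (dds_lam0 Xi) ltr01 (dds_phi0 Xi) mulr1.
have I1 : I (fun=> `|1|) <= 1.
  by rewrite normr1 Rintegral_cst // [fine _](congr1 fine (mu_setT mu)) mulr1.
have s1 x : `|1 : R| <= 1 * 1 `^ q by rewrite normr1 powR1 mulr1.
have Hn := hC 1 (fun=> 1) 1 (lexx _) ler01 P1 s1 I1.
rewrite !powR1 !mulr1 in Hn.
have := H (le_Pi n1 P1).
rewrite (RintegralE mufin (bounded_meas_cst 1)) Rintegral_cst //.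
rewrite [fine _](congr1 fine (mu_setT mu)) mulr1 integral_cst // mul1e => H1.
have : (`|1 - nu setT| <= (A * C)%:E)%E.
  apply: le_trans H1 _; apply: (@le_trans _ _ ((A * C)%:E * (n `^ (- gamma))%:E)%E).
    apply: lee_wpmul2r; first by rewrite lee_fin powR_ge0.
    by rewrite EFinM; apply: lee_wpmul2l; rewrite ?lee_fin ?(ltW A_gt0).
  rewrite -EFinM lee_fin ler_piMr ?mulr_ge0 ?(ltW A_gt0) ?(ltW C0) //.
  by rewrite -[leRHS](powRr0 n) ler_powR // oppr_le0 ltW.
case: (nu setT) (measure_ge0 nu setT) => [v|//|//] v0.
by rewrite -EFinB /= !lee_fin => /ler_normlP[]; rewrite opprB lerBlDl.
Qed.

Lemma local_mass : exists n0 C : R, [/\ 1 <= n0, 0 < C & forall n Gnu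
  (nu : {measure set (g_sigma_algebraType Gnu) -> \bar R}) x,
  n0 <= n -> (open : set (set X)) `<=` <<s Gnu >> -> quadrature n nu ->
  (nu (cball rho x n^-1) <= (C * n `^ (- tau))%:E)%E].
Proof.
have q0 := dds_q_gt0 Xi.
have [CH CH0 hCH] := H_norm_le Xi hh r_gt0 gamma_gt0 r_gt p_ge1.
have [Cm Cm0 hCm] := total_mass.
have [K K0 hK] := christoffel Xi.
have [B [N0 [B2 N01 hB]]] := product_approx (S := 2 * q) (mulr_gt0 (ltr0Sn _ _) q0) prodA.
(* With [m = eta * n], the bound [B^-1] places the approximants of the products in [Pi_ n], and
   [beta] makes the ball of radius [n^-1] fit into that of radius [beta / m]. *)
pose eta := Num.min B^-1 beta.
have B0 : 0 < B by lra.
have eta0 : 0 < eta by rewrite lt_min invr_gt0 B0.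
have etaB : eta <= B^-1 by rewrite ge_min lexx.
have etab : eta <= beta by rewrite ge_min lexx orbT.
(* Covers both bounds on [psi]: [L + E] for the integral and [L ^+ 2 + E] for the supremum, with
   [E = 2 * K ^+ 2]. *)
pose K' := K + 3 * K ^+ 2.
have K'0 : 0 < K' by rewrite addr_gt0 // mulr_gt0 // exprn_gt0.
pose D := c0 ^+ 2 * eta `^ (2 * q).
have D0 : 0 < D by rewrite mulr_gt0 ?exprn_gt0 ?powR_gt0.
(* The summands come from the [mu]-integral of [psi], from the quadrature error, and from the
   product error times the total mass of [nu]. Dividing by [D] undoes the lower bound on the squared
   kernel, rescaled from [m] to [n]. *)
pose C := (K' + A * CH * K' + 2 * K ^+ 2 * Cm) / D.
have C0 : 0 < C.
  by rewrite divr_gt0 // !addr_gt0 ?mulr_gt0 ?exprn_gt0.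
exists (N0 / eta + 1), C; split => //.
  by rewrite lerDr divr_ge0 ?(ltW eta0) // (le_trans ler01).
move=> n Gnu nu x nN oG Hq; set m := eta * n.
have nNe : N0 / eta <= n by apply: le_trans nN; rewrite lerDl.
have mN0 : N0 <= m by rewrite /m mulrC -ler_pdivrMr.
have m1 : 1 <= m by exact: le_trans mN0.
have m0 : 0 < m by exact: lt_le_trans m1.
have n0 : 0 < n by rewrite -(pmulr_rgt0 _ eta0).
have Bmn : B * m <= n by rewrite /m mulrA ler_piMl ?(ltW n0) // mulrC -ler_pdivlMr // div1r.
have mn : m <= n by apply: le_trans Bmn; rewrite ler_peMl ?(ltW m0) //; lra.
have n1 : 1 <= n by exact: le_trans mn.
have nuC := hCm _ _ nu n1 Hq.
have nufin : (nu setT < +oo)%E by apply: le_lt_trans nuC _; rewrite ltry.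
have bnu j : @bounded_meas _ (g_sigma_algebraType Gnu) R (phi j).
  split; last exact: dds_phi_bounded Xi j.
  by apply: continuous_borel_measurable oG _; exact: dds_phi_continuous Xi j.
have [J hJ] := lam_cut Xi m.
have lamJ j : (j < J)%N -> lam j <= m by rewrite hJ => /ltW.
have chris y := hK m y J m1 lamJ.
set L := K * m `^ q in chris.
have L0 : 0 < L by rewrite mulr_gt0 // powR_gt0.
(* The number of frequencies below [m]: integrate the Christoffel bound, each [phi j ^+ 2] having
   integral 1. *)
have JL : J%:R <= L.
  have : I (fun y => \sum_(j < J) phi j y ^+ 2) <= L.
    apply: le_trans (bounded_meas_le mufin _ (bounded_meas_cst L) chris) _.
      by apply: bounded_meas_sum => j; exact: bounded_measX.
    by rewrite Rintegral_cst // [fine _](congr1 fine (mu_setT mu)) mulr1.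
  rewrite bounded_meas_Rintegral_sum //; last by move=> j; exact: bounded_measX.
  rewrite (eq_bigr (fun=> 1)); first by rewrite sumr_const card_ord.
  move=> j _; have e : \int[mu]_y (phi j y * phi j y) = 1 by rewrite orth eqxx.
  by rewrite -[RHS]e; apply: eq_Rintegral => y _; rewrite expr2.
pose b j := h (lam j / m) * phi j x.
pose Phi y := \sum_(j < J) b j * phi j y.
have PhiE y : Phi_kernel lam phi h m x y = Phi y.
  apply: (cvg_lim (@Rhausdorff R)); apply: cvg_near_cst; exists J => // J' /= JJ'.
  rewrite /series /= big_mkord /Phi (big_ord_widen J' (fun j => b j * phi j y) JJ').
  rewrite [RHS]big_mkcond /=; apply: eq_bigr => j _; case: ifPn => //.
  by rewrite hJ -leNgt => mj; rewrite (filter0 Xi hh) // !mul0r.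
have b2 : \sum_(j < J) b j ^+ 2 <= L.
  apply: le_trans (chris x); apply: ler_sum => j _; rewrite exprMn ler_piMl ?sqr_ge0 //.
  have /andP[h0 h1] := filter01 hh (divr_ge0 (lam_ge0 Xi j) (ltW m0)).
  exact: exprn_ile1.
pose e := 2 * m `^ (- (2 * q)).
have e0 : 0 <= e by rewrite mulr_ge0 // powR_ge0.
(* Outside the range of indices [Q] defaults to 0, so that every [Q] lies in [Pi_ n], as
   [Pi_lincomb] demands. *)
have /choice[Q hQ] : forall jk : nat * nat, exists P, Pi_ lam phi n P /\
    ((jk.1 < J)%N -> (jk.2 < J)%N -> forall y, `|phi jk.1 y * phi jk.2 y - P y| <= e).
  move=> [j k] /=; have [jJ|jJ] := ltnP j J; last by exists (fun=> 0); split => //; exact: Pi0.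
  have [kJ|kJ] := ltnP k J; last by exists (fun=> 0); split => //; exact: Pi0.
  have [P PP hP] := hB m j k mN0 (lamJ _ jJ) (lamJ _ kJ).
  by exists P; split => //; exact: le_Pi PP.
pose psi y := \sum_(j < J) b j * (\sum_(k < J) b k * Q (j : nat, k : nat) y).
have psiP : Pi_ lam phi n psi.
  apply: (Pi_lincomb J b (P := fun j y => \sum_(k < J) b k * Q (j, k : nat) y)) => j.
  by apply: (Pi_lincomb J b (P := fun k => Q (j, k))) => k; case: (hQ (j, k)).
have dbl : \sum_(j < J) \sum_(k < J) ((b j ^+ 2 + b k ^+ 2) / 2) =
    J%:R * \sum_(j < J) b j ^+ 2.
  exact: (sum_pair_mean J (fun j => b j ^+ 2)).
pose E := 2 * K ^+ 2.
have JbE : J%:R * (\sum_(j < J) b j ^+ 2) * e <= E.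
  have : J%:R * (\sum_(j < J) b j ^+ 2) <= L * L.
    by apply: ler_pM => //; apply: sumr_ge0 => j _; exact: sqr_ge0.
  move=> /(ler_wpM2r e0) /le_trans; apply.
  have mq : m `^ (2 * q) = m `^ q * m `^ q.
    by rewrite -powRD ?(gt_eqF m0) ?implybT //; congr (_ `^ _); ring.
  rewrite /L /e /E powRN mq le_eqVlt; apply/orP; left; apply/eqP.
  by field; rewrite gt_eqF // powR_gt0.
have close y : `|Phi y ^+ 2 - psi y| <= E.
  have -> : Phi y ^+ 2 - psi y = \sum_(j < J) \sum_(k < J)
      b j * b k * (phi j y * phi k y - Q (j : nat, k : nat) y).
    rewrite expr2 /Phi /psi mulr_suml -sumrB; apply: eq_bigr => j _.
    rewrite -mulrA -mulrBr !mulr_sumr -sumrB mulr_sumr; apply: eq_bigr => k _; ring.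
  apply: le_trans JbE; rewrite -dbl mulr_suml.
  apply: le_trans (ler_norm_sum _ _ _) _; apply: ler_sum => j _; rewrite mulr_suml.
  apply: le_trans (ler_norm_sum _ _ _) _; apply: ler_sum => k _.
  rewrite normrM; apply: ler_pM => //.
    rewrite normrM -[b j ^+ 2]real_normK ?num_real // -[b k ^+ 2]real_normK ?num_real //.
    by have := sqr_ge0 (`|b j| - `|b k|); lra.
  by have [_] := hQ (j : nat, k : nat); apply; exact: ltn_ord.
have PhiL y : Phi y ^+ 2 <= L ^+ 2.
  rewrite -real_normK ?num_real // ler_sqr ?nnegrE ?(ltW L0) //.
  apply: le_trans (ler_norm_sum _ _ _) _.
  apply: (@le_trans _ _ (\sum_(j < J) ((b j ^+ 2 + phi j y ^+ 2) / 2))).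
    apply: ler_sum => j _.
    rewrite normrM -[b j ^+ 2]real_normK ?num_real // -[phi j y ^+ 2]real_normK ?num_real //.
    by have := sqr_ge0 (`|b j| - `|phi j y|); lra.
  by rewrite -mulr_suml big_split /=; have := chris y; lra.
have IPhi : I (fun y => Phi y ^+ 2) <= L by rewrite (Rintegral_comb_sqr mufin bphi orth).
have E0 : 0 < E by rewrite mulr_gt0 // exprn_gt0.
have mqn : m `^ q <= n `^ q.
  by apply: ge0_ler_powR; rewrite ?nnegrE ?(ltW q0) ?(ltW m0) ?(ltW n0).
have nq1 : 1 <= n `^ q by rewrite -(powRr0 n) ler_powR // ltW.
have nq0 : 0 < n `^ q by exact: lt_le_trans nq1.
have LE : L + E <= K' * n `^ q.
  rewrite /L /E /K'; have := ler_wpM2l (ltW K0) mqn; have := sqr_ge0 K; nra.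
have psiS y : `|psi y| <= K' * n `^ q * n `^ q.
  have : `|psi y| <= L ^+ 2 + E.
    have -> : psi y = Phi y ^+ 2 - (Phi y ^+ 2 - psi y) by ring.
    apply: le_trans (ler_normB _ _) _; apply: lerD => //.
    by rewrite ger0_norm ?sqr_ge0.
  move=> /le_trans; apply.
  have L2 : L ^+ 2 <= K ^+ 2 * (n `^ q * n `^ q).
    rewrite exprMn; apply: ler_wpM2l; first exact: sqr_ge0.
    by rewrite expr2; apply: ler_pM => //; exact: powR_ge0.
  have : 1 <= n `^ q * n `^ q by nra.
  rewrite /E /K' -mulrA; move: (n `^ q * n `^ q) L2 => z; have := sqr_ge0 K; nra.
have bpsi : bm psi := bounded_meas_Pi Xi psiP.
have bPhi : bm Phi := bounded_meas_comb bphi J b.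
have psiI : I (fun y => `|psi y|) <= K' * n `^ q.
  have pt y : `|psi y| <= Phi y ^+ 2 + E.
    have -> : psi y = Phi y ^+ 2 - (Phi y ^+ 2 - psi y) by ring.
    apply: le_trans (ler_normB _ _) _; apply: lerD => //.
    by rewrite ger0_norm ?sqr_ge0.
  have bP2 := bounded_measX 2 bPhi.
  apply: le_trans (bounded_meas_le mufin (bounded_meas_norm bpsi)
    (bounded_measD bP2 (bounded_meas_cst E)) pt) _.
  rewrite bounded_meas_RintegralD //; last exact: bounded_meas_cst.
  rewrite Rintegral_cst // [fine _](congr1 fine (mu_setT mu)) mulr1.
  by apply: le_trans LE; rewrite lerD2r.
have Kn0 : 0 <= K' * n `^ q by rewrite mulr_ge0 ?powR_ge0 // ltW.
have Hn := hCH n psi _ n1 Kn0 psiP psiS psiI.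
rewrite -/tau in Hn.
have bpsin : @bounded_meas _ (g_sigma_algebraType Gnu) R psi.
  have [a [J' [_ _ aE]]] := Pi_coef psiP.
  by rewrite (aE J') //; exact: (bounded_meas_comb bnu).
have bPhin : @bounded_meas _ (g_sigma_algebraType Gnu) R Phi := bounded_meas_comb bnu J b.
have ng : n `^ gamma * n `^ (- gamma) = 1 by rewrite powRN divff // gt_eqF // powR_gt0.
have quad : \int[nu]_y psi y <= I psi + A * CH * (K' * n `^ q * n `^ (q - tau)).
  have := Hq psi psiP.
  rewrite (RintegralE mufin bpsi) (RintegralE nufin bpsin) -EFinB.
  have : (A%:E * H_norm mu lam phi r gamma p psi * (n `^ (- gamma))%:E <=
      (A * CH * (K' * n `^ q * n `^ (q - tau)))%:E)%E.
    rewrite (_ : A * CH * _ =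
      A * (CH * n `^ gamma * (K' * n `^ q * n `^ (q - tau))) * n `^ (- gamma)).
      rewrite EFinM; apply: lee_wpmul2r; first by rewrite lee_fin powR_ge0.
      by rewrite EFinM; apply: lee_wpmul2l; rewrite ?lee_fin ?(ltW A_gt0).
    by rewrite -[LHS]mulr1 -ng; ring.
  move=> h1 h2; have := le_trans h2 h1; rewrite /= lee_fin => /ler_normlP[]; lra.
have mB := measurable_cball Xi x n^-1 oG.
have bB := bounded_meas_indic (R := R) mB.
set W := c0 ^+ 2 * (m `^ q) ^+ 2.
have low y : W * (\1_(cball rho x n^-1 : set (g_sigma_algebraType Gnu)) : _ -> R) y <= psi y + E.
  have h1 : Phi y ^+ 2 <= psi y + E by have := close y; rewrite ler_norml => /andP[]; lra.
  apply: le_trans h1; rewrite indicE.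
  have [/set_mem yB|_] := boolP (y \in _); last by rewrite mulr0 sqr_ge0.
  rewrite mulr1 /W -exprMn -[leRHS]real_normK ?num_real //.
  rewrite ler_sqr ?nnegrE ?mulr_ge0 ?powR_ge0 ?(ltW c0_gt0) // -PhiE.
  apply: Phi_lb => //; apply: le_trans yB _.
  by rewrite /m invfM mulrA ler_peMl ?invr_ge0 ?(ltW n0) // ler_pdivlMr // mul1r.
have := bounded_meas_le nufin (bounded_measZ W bB)
  (bounded_measD bpsin (bounded_meas_cst E)) low.
rewrite bounded_meas_RintegralZ // Rintegral_indic_fine //.
rewrite bounded_meas_RintegralD //; last exact: bounded_meas_cst.
rewrite Rintegral_cst // => main.
have Bfin : nu (cball rho x n^-1) \is a fin_num.
  rewrite ge0_fin_numE //; apply: le_lt_trans nufin; apply: le_measure; rewrite ?inE //.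
rewrite -(fineK Bfin) lee_fin.
set v := fine _ in main *; set w := fine (nu setT) in main.
have wC : w <= Cm.
  by rewrite -lee_fin fineK // ge0_fin_numE.
have Ipsi : I psi <= K' * n `^ q.
  apply: le_trans psiI; apply: le_trans (ler_norm _) _.
  exact: bounded_meas_Rintegral_norm.
have /andP[tau0 tauq] := tau_itv.
have qt1 : 1 <= n `^ (q - tau) by rewrite -(powRr0 n) ler_powR // subr_ge0.
set z := n `^ q * n `^ (q - tau).
have z1 : n `^ q <= z by rewrite ler_peMr // ltW.
have z2 : 1 <= z by exact: le_trans z1.
have main2 : W * v <= (C * D) * z.
  have -> : C * D = K' + A * CH * K' + 2 * K ^+ 2 * Cm by rewrite /C divfK // gt_eqF.
  apply: le_trans main _.
  have i1 : K' * n `^ q <= K' * z by rewrite ler_pM2l.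
  have i2 : E * w <= E * Cm * z.
    rewrite -mulrA ler_pM2l //; apply: le_trans wC _.
    by rewrite ler_peMr // ltW.
  have i3 : A * CH * (K' * n `^ q * n `^ (q - tau)) = A * CH * K' * z by rewrite /z; ring.
  rewrite mulrDl; apply: lerD; last exact: i2.
  rewrite mulrDl; apply: le_trans quad _; rewrite i3 lerD2r.
  exact: le_trans Ipsi i1.
have WE : W = D * (n `^ q * n `^ q).
  rewrite /W /D /m powRM ?(ltW eta0) ?(ltW n0) // (_ : 2 * q = q + q); last by ring.
  by rewrite powRD ?(gt_eqF eta0) ?implybT //; ring.
have zE : z = n `^ q * n `^ q * n `^ (- tau).
  by rewrite /z powRD ?(gt_eqF n0) ?implybT // mulrA.
have Y0 : 0 < D * (n `^ q * n `^ q) by rewrite mulr_gt0 // mulr_gt0.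
rewrite -(ler_pM2l Y0) -WE; apply: le_trans main2 _.
by rewrite WE zE le_eqVlt; apply/orP; left; apply/eqP; ring.
Qed.

End RegularMeasures.

Unset Implicit Arguments.
Set Strict Implicit.
Set Printing Implicit Defensive.

Theorem theorem5 (R : realType) (X : ptopologicalType) (rho : X -> X -> R)
    (G : set (set X)) (mu : probability (g_sigma_algebraType G) R)
    (lam : R^nat) (phi : nat -> X -> R) (q : R) (h : R -> R)
    (beta c0 : R) (p : \bar R) (gamma r A : R)
    (Xi : data_defined_space rho mu lam phi q)
    (prodA : product_assumption mu lam phi)
    (hh : filter_function h)
    (beta_gt0 : 0 < beta) (c0_gt0 : 0 < c0)
    (Phi_lb : forall (x : X) (m : R), 1 <= m ->
       forall y : X, cball rho x (beta / m) y ->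
         c0 * m `^ q <= `|Phi_kernel lam phi h m x y|)
    (p_ge1 : (1 <= p)%E) (gamma_gt0 : 0 < gamma) (r_gt : gamma < r)
    (A_gt0 : 0 < A) :
  exists2 c : R, 0 < c &
    forall (n : R) (Gnu : set (set X))
        (nu : {measure set (g_sigma_algebraType Gnu) -> \bar R}),
      1 <= n ->
      complete_sfinite_borel nu ->
      (forall P : X -> R, Pi_ lam phi n P ->
         (`| \int[mu]_x (P x)%:E - \int[nu]_x (P x)%:E |
            <= A%:E * H_norm mu lam phi r gamma p P * (n `^ (- gamma))%:E)%E) ->
      (forall x : X,
         (nu (cball rho x n^-1) <= (c * n `^ (- fine (q%:E / p)%E))%:E)%E) /\
      (p = 1%E ->
         [/\ (tvar nu setT <= c%:E)%E,
             regular_measure rho q nu n^-1 &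
             (regularity_norm rho q nu n^-1 <= c%:E)%E]).
Proof.
have [C1 C10 hC1] := total_mass Xi hh p_ge1 gamma_gt0 r_gt A_gt0.
have [n0 [C2 [n01 C20 hC2]]] :=
  local_mass Xi prodA hh beta_gt0 c0_gt0 Phi_lb p_ge1 gamma_gt0 r_gt A_gt0.
have /andP[tau0 tauq] := tau_itv Xi p_ge1.
set tau := fine _ in hC2 tau0 tauq.
have n0q : 1 <= n0 `^ q by rewrite -(powRr0 n0) ler_powR // (le_trans tau0).
(* [C2] serves for [n >= n0]. For [n < n0] the total mass bound [C1] suffices, since [n]^ tau <= n0
   [^ q]. *)
pose c := C1 * n0 `^ q + C2.
have C1c : C1 <= c.
  by apply: (@le_trans _ _ (C1 * n0 `^ q)); [rewrite ler_peMr // ltW|rewrite lerDl ltW].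
have c_gt0 : 0 < c by exact: lt_le_trans C1c.
exists c => // n Gnu nu n1 [oG _ _] Hq.
have n_gt0 : 0 < n by exact: lt_le_trans n1.
have nuX := hC1 n Gnu nu n1 Hq.
have mball x := measurable_cball Xi x n^-1 oG.
have ball x : (nu (cball rho x n^-1) <= (c * n `^ (- tau))%:E)%E.
  have [nn0|nn0] := leP n0 n.
    apply: le_trans (hC2 n Gnu nu x nn0 oG Hq) _.
    rewrite lee_fin ler_wpM2r ?powR_ge0 // lerDr mulr_ge0 ?powR_ge0 //.
    exact: ltW.
  apply: (@le_trans _ _ (nu setT)).
    by apply: le_measure; rewrite ?inE.
  apply: le_trans nuX _; rewrite lee_fin powRN ler_pdivlMr ?powR_gt0 //.
  apply: (@le_trans _ _ (C1 * n0 `^ q)); last by rewrite lerDl ltW.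
  rewrite ler_pM2l //; apply: (@le_trans _ _ (n `^ q)); first by rewrite ler_powR.
  apply: ge0_ler_powR; rewrite ?nnegrE ?(ltW nn0) ?(ltW n_gt0) ?(le_trans ler01 n01) //.
  exact: le_trans tau0 tauq.
split=> // p1.
have tauE : tau = q by rewrite /tau p1 inve1 mule1.
have reg : regularity_bound rho q nu n^-1 c.
  move=> x; apply: le_trans (tvar_le nu _) _; apply: le_trans (ball x) _.
  by rewrite tauE lee_fin ler_pM2l // -(powR_inv1 (ltW n_gt0)) -powRrM mulN1r.
split.
- by apply: le_trans (tvar_le nu _) _; apply: le_trans nuX _; rewrite lee_fin.
- by exists c.
- by apply: ereal_inf_lbound; exists c.
Qed.
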